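(* Let $M$ be a Sinnott module over $\Lambda=\mathbb{Z}_\ell[[\Gamma]]$. Then the sequences $$\{a_n:=\mathrm{rank}_{\mathbb{Z}_\ell}M(n)\}_{n\in\mathbb{N}}\quad\text{and}\quad\{b_n:=\mathrm{rank}_\ell M(n)\}_{n\in\mathbb{N}}$$ converge $p$-adically. If $M$ is torsion, then also the sequence $$\{c_n:=|M(n)|=\ell^{v_\ell(|M(n)|)}\}_{n\in\mathbb{N}}$$ converges $p$-adically.
   Context: Let $\ell\neq p$ be primes and $\Gamma=\varprojlim_{n\in\mathbb{N}}\Gamma_n$ with $\Gamma_n$ finite abelian $p$-groups and surjective transition maps; $G_n=\mathrm{Ker}(\Gamma\to\Gamma_n)$; $\Lambda=\mathbb{Z}_\ell[[\Gamma]]=\varprojlim\mathbb{Z}_\ell[\Gamma_n]$. Fix $\overline{\mathbb{Q}}\hookrightarrow\overline{\mathbb{Q}}_\ell$. $\Gamma^\vee$ is the group of continuous characters of $\Gamma$ with values in roots of unity (in $\overline{\mathbb{Q}}_\ell$), with the action of $G_{\mathbb{Q}_\ell}=\mathrm{Gal}(\overline{\mathbb{Q}}_\ell/\mathbb{Q}_\ell)$ given by $(\sigma\cdot\omega)(\gamma)=\sigma(\omega(\gamma))$; $\mathscr{R}$ is the set of orbits $[\omega]$. For each $[\omega]$, $e_{[\omega]}\in\Lambda$ is the idempotent whose image in $\mathbb{Z}_\ell[\Gamma_n]$ is $\sum_{\chi\in[\omega]}\frac1{|\Gamma_n|}\sum_{\gamma\in\Gamma_n}\chi(\gamma^{-1})\gamma$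 if $\omega$ factors through $\Gamma_n$, and $0$ otherwise. $\Lambda_{[\omega]}=e_{[\omega]}\Lambda\simeq\mathbb{Z}_\ell[\omega(\Gamma)]$, $\Lambda=\prod_{[\omega]}\Lambda_{[\omega]}$, and $M_{[\omega]}=e_{[\omega]}M$ for a $\Lambda$-module $M$. $I_n\subseteq\Lambda$ is the ideal generated by $\{\gamma-1:\gamma\in G_n\}$. $\mathscr{S}_n=\{[\omega]\in\mathscr{R}:\omega(\Gamma)=\boldsymbol{\mu}_{p^n}\}$, $\varepsilon_n=\sum_{[\omega]\in\mathscr{S}_n}e_{[\omega]}\in\Lambda$ (a convergent sum), and $M(n)=\bigoplus_{m=0}^n\varepsilon_mM$. A $\Lambda$-module $M$ is a Sinnott module if every $M_{[\omega]}$ is a finitely generated $\Lambda_{[\omega]}$-module, the natural map $M\to\varprojlim M/I_nM$ is bijective, and for every $n$ the set $\{[\omega]\in\mathscr{S}_n:M_{[\omega]}\neq0\}$ is finite. It is torsion if every $M_{[\omega]}$ is a torsion $\Lambda_{[\omega]}$-module. For a finitely generated $\mathbb{Z}_\ell$-module $N$, $\mathrm{rank}_\ell N=\dim_{\mathbb{F}_\ell}N/\ell N$.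
   Formalization: I_n is taken to be the closed ideal generated by γ-1, γ in G_n (the kernel of Λ → Z_ℓ[Γ_n]); this is the same for topologically finitely generated Γ, while for e.g. Γ = ∏F_p the abstract ideal admits Sinnott modules with M(1) of infinite rank. *)

(* Defs.v *)
From HB Require Import structures.
From mathcomp Require Import all_boot all_order all_algebra all_fingroup.
From mathcomp Require Import all_solvable.
From mathcomp Require Import boolp classical_sets functions cardinality fsbigop.

Set Implicit Arguments.
Unset Strict Implicit.
Unset Printing Implicit Defensive.

Import GRing.Theory.
Local Open Scope ring_scope.

Section InverseLimitRing.
Variables (R : nat -> nzRingType) (f : forall n, {rmorphism R n.+1 -> R n}).

Record invlim := InvLim {
  lim_comp :> forall n, R n;
  lim_compP : forall n, f n (lim_comp n.+1) = lim_comp n }.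

HB.instance Definition _ := gen_eqMixin invlim.
HB.instance Definition _ := gen_choiceMixin invlim.

Lemma invlim_ext (x y : invlim) : (forall n, x n = y n) -> x = y.
Proof.
case: x y => [x hx] [y hy] /= E.
have e : x = y by apply: functional_extensionality_dep.
by case: y / e hy E => hy _; congr InvLim; exact: Prop_irrelevance.
Qed.

Lemma zero_compat n : f n (0 : R n.+1) = 0. Proof. exact: rmorph0. Qed.
Lemma one_compat n : f n (1 : R n.+1) = 1. Proof. exact: rmorph1. Qed.
Lemma opp_compat (x : invlim) n : f n (- x n.+1) = - x n.
Proof. by rewrite rmorphN lim_compP. Qed.
Lemma add_compat (x y : invlim) n : f n (x n.+1 + y n.+1) = x n + y n.
Proof. by rewrite rmorphD !lim_compP. Qed.
Lemma mul_compat (x y : invlim) n : f n (x n.+1 * y n.+1) = x n * y n.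
Proof. by rewrite rmorphM !lim_compP. Qed.

Definition lim_zero := InvLim zero_compat.
Definition lim_one := InvLim one_compat.
Definition lim_opp x := InvLim (opp_compat x).
Definition lim_add x y := InvLim (add_compat x y).
Definition lim_mul x y := InvLim (mul_compat x y).

Fact lim_addA : associative lim_add.
Proof. by move=> x y z; apply: invlim_ext => n; exact: addrA. Qed.
Fact lim_addC : commutative lim_add.
Proof. by move=> x y; apply: invlim_ext => n; exact: addrC. Qed.
Fact lim_add0 : left_id lim_zero lim_add.
Proof. by move=> x; apply: invlim_ext => n; exact: add0r. Qed.
Fact lim_addN : left_inverse lim_zero lim_opp lim_add.
Proof. by move=> x; apply: invlim_ext => n; exact: addNr. Qed.
HB.instance Definition _ :=
  GRing.isZmodule.Build invlim lim_addA lim_addC lim_add0 lim_addN.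

Fact lim_mulA : associative lim_mul.
Proof. by move=> x y z; apply: invlim_ext => n; exact: mulrA. Qed.
Fact lim_mul1 : left_id lim_one lim_mul.
Proof. by move=> x; apply: invlim_ext => n; exact: mul1r. Qed.
Fact lim_mulr1 : right_id lim_one lim_mul.
Proof. by move=> x; apply: invlim_ext => n; exact: mulr1. Qed.
Fact lim_mulDl : left_distributive lim_mul lim_add.
Proof. by move=> x y z; apply: invlim_ext => n; exact: mulrDl. Qed.
Fact lim_mulDr : right_distributive lim_mul lim_add.
Proof. by move=> x y z; apply: invlim_ext => n; exact: mulrDr. Qed.
Fact lim_one_neq0 : lim_one != 0 :> invlim.
Proof.
apply/eqP => /(congr1 (fun x : invlim => x 0%N)) /= /eqP.
by rewrite oner_eq0.
Qed.
HB.instance Definition _ := GRing.Zmodule_isNzRing.Build invlim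
  lim_mulA lim_mul1 lim_mulr1 lim_mulDl lim_mulDr lim_one_neq0.

End InverseLimitRing.

Section PadicIntegers.
Variable p : nat.

Definition Zpow_red n (x : 'Z_(p ^ n.+2)) : 'Z_(p ^ n.+1) := inZp x.

Lemma Zpow_red_dvd n :
  ((Zp_trunc (p ^ n.+1)).+2 %| (Zp_trunc (p ^ n.+2)).+2)%N.
Proof.
have [p1|] := ltnP 1 p; last first.
  by case: p => [|[|]] //; rewrite ?exp0n ?exp1n.
have gt1 k : (1 < p ^ k.+1)%N.
  by rewrite (leq_trans p1) // -{1}(expn1 p) leq_pexp2l // ltnW.
by rewrite !Zp_cast // dvdn_exp2l.
Qed.

Fact Zpow_red_nmod n : nmod_morphism (@Zpow_red n).
Proof.
split=> [|x y]; apply: val_inj => /=; first by rewrite mod0n.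
by rewrite modn_dvdm ?Zpow_red_dvd // modnDm.
Qed.
Fact Zpow_red_monoid n : monoid_morphism (@Zpow_red n).
Proof.
split=> [|x y]; apply: val_inj => //=.
by rewrite modn_dvdm ?Zpow_red_dvd // modnMm.
Qed.
HB.instance Definition _ n :=
  GRing.isNmodMorphism.Build _ _ (@Zpow_red n) (@Zpow_red_nmod n).
HB.instance Definition _ n :=
  GRing.isMonoidMorphism.Build _ _ (@Zpow_red n) (@Zpow_red_monoid n).

(* Component n of a p-adic integer is its residue modulo p ^ n.+1: the limit  *)
(* starts at Z/p, since 'Z_1 is not the zero ring but Z/2.                    *)
Definition padic_int : Type :=
  @invlim (fun n => 'Z_(p ^ n.+1)) (fun n => @Zpow_red n).

HB.instance Definition _ := GRing.NzRing.on padic_int.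
Fact padic_int_mulC : commutative (@GRing.mul padic_int).
Proof. by move=> x y; apply: invlim_ext => n; exact: mulrC. Qed.
HB.instance Definition _ := GRing.PzRing_hasCommutativeMul.Build padic_int padic_int_mulC.

End PadicIntegers.

Section GroupRing.
Variable R : nzRingType.

(* An alias is needed: {ffun G -> R} carries the pointwise product.           *)
Definition gring (G : finGroupType) : Type := {ffun G -> R}.

Section Ring.
Variable G : finGroupType.

HB.instance Definition _ := GRing.Zmodule.on (gring G).

Definition gr_mono (c : R) (g : G) : gring G :=
  [ffun h => if h == g then c else 0].

Definition gr_mul (x y : gring G) : gring G :=
  [ffun g => \sum_h x h * y (h^-1 * g)%g].

Fact gr_mulA : associative gr_mul.
Proof.
move=> x y z; apply/ffunP => g; rewrite !ffunE.
under eq_bigr => h _.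
  rewrite ffunE big_distrr /= (reindex_inj (mulgI h^-1)%g) /=.
  under eq_bigr => k _ do rewrite mulrA invMg invgK mulgA mulgK.
  over.
rewrite exchange_big /=; apply: eq_bigr => k _.
by rewrite ffunE big_distrl.
Qed.
Fact gr_mul1 : left_id (gr_mono 1 1%g) gr_mul.
Proof.
move=> x; apply/ffunP => g; rewrite ffunE (bigD1 1%g) //= ffunE eqxx mul1r.
rewrite invg1 mul1g big1 ?addr0 // => h /negbTE h1.
by rewrite ffunE h1 mul0r.
Qed.
Fact gr_mulr1 : right_id (gr_mono 1 1%g) gr_mul.
Proof.
move=> x; apply/ffunP => g; rewrite ffunE (bigD1 g) //= ffunE mulVg eqxx mulr1.
rewrite big1 ?addr0 // => h /negbTE hg.
by rewrite ffunE -eq_mulVg1 hg mulr0.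
Qed.
Fact gr_mulDl : left_distributive gr_mul +%R.
Proof.
move=> x y z; apply/ffunP => g; rewrite !ffunE -big_split /=.
by apply: eq_bigr => h _; rewrite ffunE mulrDl.
Qed.
Fact gr_mulDr : right_distributive gr_mul +%R.
Proof.
move=> x y z; apply/ffunP => g; rewrite !ffunE -big_split /=.
by apply: eq_bigr => h _; rewrite ffunE mulrDr.
Qed.
Fact gr_one_neq0 : gr_mono 1 1%g != 0 :> gring G.
Proof. by apply/eqP => /ffunP /(_ 1%g) /eqP; rewrite !ffunE eqxx oner_eq0. Qed.
HB.instance Definition _ := GRing.Zmodule_isNzRing.Build (gring G)
  gr_mulA gr_mul1 gr_mulr1 gr_mulDl gr_mulDr gr_one_neq0.

End Ring.

Section Pushforward.
Variables (G H : finGroupType) (f : {morphism [set: G] >-> H}).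

Definition gr_map (x : gring G) : gring H :=
  [ffun h => \sum_(g | f g == h) x g].

Lemma gr_map_mono c g : gr_map (gr_mono c g) = gr_mono c (f g).
Proof.
apply/ffunP => h; rewrite !ffunE eq_sym.
under eq_bigr do rewrite ffunE.
rewrite -big_mkcondr /=; have [fg|fg] := eqVneq (f g) h.
  by rewrite (big_pred1 g) // => k /=; have [->|] := eqVneq k g;
    rewrite ?fg ?eqxx ?andbF.
by rewrite big_pred0 // => k /=; have [->|] := eqVneq k g;
  rewrite ?(negbTE fg) ?andbF.
Qed.

Fact gr_map_nmod : nmod_morphism gr_map.
Proof.
split=> [|x y]; apply/ffunP => h; rewrite !ffunE.
  by apply: big1 => g _; rewrite ffunE.
by rewrite -big_split; apply: eq_bigr => g _; rewrite ffunE.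
Qed.
Fact gr_map_monoid : monoid_morphism gr_map.
Proof.
split=> [|x y]; first by rewrite gr_map_mono morph1.
apply/ffunP => h; rewrite !ffunE.
under eq_bigr do rewrite ffunE.
rewrite exchange_big /= [LHS](partition_big f predT) //=.
apply: eq_bigr => k _; rewrite ffunE big_distrl /=.
apply: eq_bigr => g /eqP fg; rewrite ffunE big_distrr /=.
rewrite (reindex_inj (mulgI g)) /=.
apply: eq_big => [u|u _]; last by rewrite mulKg.
by rewrite morphM ?inE // fg -(inj_eq (mulgI k^-1%g)) mulKg.
Qed.
HB.instance Definition _ := GRing.isNmodMorphism.Build _ _ gr_map gr_map_nmod.
HB.instance Definition _ :=
  GRing.isMonoidMorphism.Build _ _ gr_map gr_map_monoid.

End Pushforward.
End GroupRing.

Record pro_p_system (p : nat) := ProPSystem {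
  level :> nat -> finGroupType;
  transition : forall n, {morphism [set: level n.+1] >-> level n};
  level_abelian : forall n, abelian [set: level n];
  level_pgroup : forall n, (p.-group [set: level n])%g;
  transition_surj : forall n, (transition n @* [set: level n.+1])%g = [set: level n]%SET }.

Section InverseLimitGroup.
Variables (p : nat) (G : pro_p_system p).

Record proGroup := ProGroup {
  pro_comp :> forall n, G n;
  pro_compP : forall n, transition G n (pro_comp n.+1) = pro_comp n }.

HB.instance Definition _ := gen_eqMixin proGroup.
HB.instance Definition _ := gen_choiceMixin proGroup.

Lemma proGroup_ext (x y : proGroup) : (forall n, x n = y n) -> x = y.
Proof.
case: x y => [x hx] [y hy] /= E.
have e : x = y by apply: functional_extensionality_dep.
by case: y / e hy E => hy _; congr ProGroup; exact: Prop_irrelevance.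
Qed.

Lemma pro_one_compat n : transition G n 1%g = 1%g. Proof. exact: morph1. Qed.
Lemma pro_inv_compat (x : proGroup) n : transition G n (x n.+1)^-1%g = (x n)^-1%g.
Proof. by rewrite morphV ?inE // pro_compP. Qed.
Lemma pro_mul_compat (x y : proGroup) n :
  transition G n (x n.+1 * y n.+1)%g = (x n * y n)%g.
Proof. by rewrite morphM ?inE // !pro_compP. Qed.

Definition pro_one := ProGroup pro_one_compat.
Definition pro_inv x := ProGroup (pro_inv_compat x).
Definition pro_mul x y := ProGroup (pro_mul_compat x y).

Fact pro_mulA : associative pro_mul.
Proof. by move=> x y z; apply: proGroup_ext => n; exact: mulgA. Qed.
Fact pro_mul1 : left_id pro_one pro_mul.
Proof. by move=> x; apply: proGroup_ext => n; exact: mul1g. Qed.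
Fact pro_mulg1 : right_id pro_one pro_mul.
Proof. by move=> x; apply: proGroup_ext => n; exact: mulg1. Qed.
Fact pro_mulV : left_inverse pro_one pro_inv pro_mul.
Proof. by move=> x; apply: proGroup_ext => n; exact: mulVg. Qed.
Fact pro_mulgV : right_inverse pro_one pro_inv pro_mul.
Proof. by move=> x; apply: proGroup_ext => n; exact: mulgV. Qed.
HB.instance Definition _ := isGroup.Build proGroup
  pro_mulA pro_mul1 pro_mulg1 pro_mulV pro_mulgV.

End InverseLimitGroup.

Local Open Scope classical_set_scope.

Section IwasawaAlgebra.
Variables (l p : nat) (G : pro_p_system p).

Definition Lambda : Type :=
  @invlim (fun n => gring (padic_int l) (G n)) (fun n => gr_map (transition G n)).

HB.instance Definition _ := GRing.NzRing.on Lambda.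

Fact Lambda_mulC : commutative (@GRing.mul Lambda).
Proof.
move=> x y; apply: invlim_ext => n; apply/ffunP => g; rewrite !ffunE.
rewrite (reindex_inj invg_inj) (reindex_inj (mulIg g^-1)%g) /=.
apply: eq_bigr => h _; rewrite mulrC invgK mulgVK invMg invgK.
have /centsP C := level_abelian G n.
by rewrite (C g _ h^-1%g) ?inE.
Qed.
HB.instance Definition _ :=
  GRing.PzRing_hasCommutativeMul.Build Lambda Lambda_mulC.

Lemma mono_compat (c : padic_int l) (g : proGroup G) n :
  gr_map (transition G n) (gr_mono c (g n.+1)) = gr_mono c (g n).
Proof. by rewrite gr_map_mono pro_compP. Qed.

(* The image of c * g under Z_l[Gamma] -> Lambda.                             *)
Definition Lmono (c : padic_int l) (g : proGroup G) : Lambda := InvLim (mono_compat c g).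

Definition scal (c : padic_int l) : Lambda := Lmono c 1%g.

End IwasawaAlgebra.


Section Span.
Variables (A : pzRingType) (V : lmodType A).

Definition lincomb (S : set A) (X : set V) : set V :=
  [set v | exists s : seq (A * V),
    (forall q, q \in s -> S q.1 /\ X q.2) /\ v = \sum_(q <- s) q.1 *: q.2].

Definition fingen (S : set A) (N : set V) : Prop :=
  exists s : seq V, [set` s] `<=` N /\ N = lincomb S [set` s].

End Span.

Section AugmentationIdeals.
Variables (l p : nat) (G : pro_p_system p).

Definition Gker n : set (proGroup G) := [set g | g n = 1%g].

(* Lambda carries the inverse limit topology: the kernels of the maps         *)
(* Lambda -> (Z / l ^ j.+1)[Gamma_k] form a basis of neighbourhoods of 0.     *)
Definition Lclosure (J : set (Lambda l G)) : set (Lambda l G) :=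
  [set a : Lambda l G | forall k j, exists2 b, J b &
    forall g, (a k g : padic_int l) j = (b k g : padic_int l) j].

(* Ideals of the profinite ring Lambda are generated topologically. When      *)
(* Gamma is not finitely generated the abstract ideal need not be closed.     *)
Definition aug_ideal n : set (Lambda l G) :=
  Lclosure (@lincomb _ (Lambda l G)^o setT
              [set Lmono 1 g - (1 : Lambda l G) | g in Gker n]).

End AugmentationIdeals.

Section Characters.
Variables (l p : nat) (G : pro_p_system p).
Variables (K : closedFieldType) (iota : {rmorphism padic_int l -> K}).

(* K, through iota, is an algebraic closure of Q_l = Frac Z_l.                *)
Definition is_algclosure : Prop :=
  injective iota /\
  forall x : K, exists2 q : {poly padic_int l}, q != 0 & root (map_poly iota q) x.

Definition galois_group : set {rmorphism K -> K} :=
  [set s | bijective s /\ forall c, s (iota c) = iota c].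

(* Roots of unity are discrete and the fibres of the projections to the       *)
(* levels are a basis of the topology of Gamma.                               *)
Definition dual_group : set (proGroup G -> K) :=
  [set w : proGroup G -> K |
    [/\ forall x y, w (x * y)%g = w x * w y,
        forall x, exists2 n, (0 < n)%N & w x ^+ n = 1 &
        forall x : proGroup G, exists n, forall y : proGroup G,
          y n = x n -> w y = w x]].

Definition orbit_of (w : proGroup G -> K) : set (proGroup G -> K) :=
  [set fun g => s (w g) | s in galois_group].

Definition char_orbits : set (set (proGroup G -> K)) :=
  [set orbit_of w | w in dual_group].

Definition factors_through n (O : set (proGroup G -> K)) : Prop :=
  forall w, O w -> forall x y : proGroup G, x n = y n -> w x = w y.

(* Coefficients are compared in K. As x n runs over the whole of Gamma_n,     *)
(* at most one element of Lambda satisfies this; for an orbit O there is one, *)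
(* because the sum is Galois-invariant and integral over Z_l.                 *)
Definition idempotent_spec (O : set (proGroup G -> K)) (e : Lambda l G) :=
  forall n,
    (factors_through n O -> forall x : proGroup G,
       iota (e n (x n)) = \sum_(w \in O) (#|G n|%:R^-1 * w x^-1%g)) /\
    (~ factors_through n O -> e n = 0).

Definition idem (O : set (proGroup G -> K)) : Lambda l G :=
  xget 0 [set e | idempotent_spec O e].

Definition Sset n : set (set (proGroup G -> K)) :=
  [set orbit_of w | w in
    [set w | dual_group w /\ range w = [set z | z ^+ (p ^ n) = 1]]].

(* The limit of the convergent sum of the idem O, O in Sset n: in each        *)
(* Z_l[Gamma_k] only finitely many of them have a nonzero image.              *)
Definition eps n : Lambda l G :=
  xget 0 [set e : Lambda l G | forall k, e k = \sum_(O \in Sset n) idem O k].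

Definition Lambda_comp (O : set (proGroup G -> K)) : set (Lambda l G) :=
  [set idem O * a | a in setT].

Section Modules.
Variable M : lmodType (Lambda l G).

Definition mod_comp (O : set (proGroup G -> K)) : set M :=
  [set idem O *: x | x in setT].

Definition mod_trunc n : set M :=
  [set x | exists y : nat -> M, x = \sum_(m < n.+1) eps m *: y m].

Definition IM n : set M := lincomb (@aug_ideal l p G n) setT.

(* Bijectivity of M -> lim M / I_n M, with elements of the limit given by     *)
(* coherent sequences of representatives.                                     *)
Definition complete_mod : Prop :=
  (forall x : M, (forall n, IM n x) -> x = 0) /\
  (forall x : nat -> M, (forall n, IM n (x n.+1 - x n)) ->
     exists y : M, forall n, IM n (y - x n)).

Definition sinnott : Prop :=
  [/\ forall O, char_orbits O -> fingen (Lambda_comp O) (mod_comp O),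
      complete_mod &
      forall n, finite_set [set O | Sset n O /\ mod_comp O <> [set 0]]].

Definition torsion_mod : Prop :=
  forall O, char_orbits O -> forall x, mod_comp O x ->
    exists2 a, Lambda_comp O a /\ a <> 0 & a *: x = 0.

End Modules.
End Characters.

Arguments mod_comp {l p G K} iota M O.
Arguments mod_trunc {l p G K} iota M n.
Arguments IM {l p G} M n.

Section Ranks.
Variables (l p : nat) (G : pro_p_system p) (M : lmodType (Lambda l G)).

Definition Zfingen (N : set M) : Prop := fingen (range (@scal l p G)) N.

Definition Zindep r (x : 'I_r -> M) : Prop :=
  forall c : 'I_r -> padic_int l, \sum_i scal G (c i) *: x i = 0 -> forall i, c i = 0.

(* rank_{Z_l} N = r, i.e. dim (Q_l (x) N) = r.                                *)
Definition Zrank (N : set M) (r : nat) : Prop :=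
  [/\ Zfingen N,
      exists2 x : 'I_r -> M, (forall i, N (x i)) & Zindep x &
      forall x : 'I_r.+1 -> M, (forall i, N (x i)) -> ~ Zindep x].

(* rank_l N = r: the classes of some x_0, ..., x_(r-1) form an F_l-basis of   *)
(* N / l N.                                                                   *)
Definition lrank (N : set M) (r : nat) : Prop :=
  let lN := [set y *+ l | y in N] in
  Zfingen N /\
  exists x : 'I_r -> M,
    [/\ forall i, N (x i),
        forall y, N y -> exists c : 'I_r -> 'F_l, lN (y - \sum_i x i *+ c i) &
        forall c : 'I_r -> 'F_l, lN (\sum_i x i *+ c i) -> forall i, c i = 0].

End Ranks.

Definition padic_cvg (p : nat) (u : nat -> nat) : Prop :=
  exists x : padic_int p, forall k, exists N, forall n, (N <= n)%N ->
    ((u n)%:R : padic_int p) k = x k.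

(* Main.v *)
Require Import Defs.
From HB Require Import structures.
From mathcomp Require Import all_boot all_algebra all_fingroup all_solvable.
From mathcomp Require Import mxrepresentation separable.
From mathcomp Require Import boolp classical_sets functions cardinality fsbigop.
Import GRing.Theory.
Local Open Scope classical_set_scope.
Local Open Scope ring_scope.
Set Implicit Arguments.
Unset Strict Implicit.
Unset Printing Implicit Defensive.

(** The p-adic limits exist because the new part of [M(n)], the sum of the finitely many
    nonzero components [M_O] with [O] in [Sset n], carries a free action of a cyclic group
    of order [p ^ n].

    Let [O] be an orbit of characters with image the [p ^ n]-th roots of unity. Some
    [gamma] in [Gamma] acts on [M_O] as a root of unity of exact order [p ^ n]. For a
    [p]-th root of unity [zeta] other than [1], the relation
    [1 + zeta + ... + zeta ^ (p - 1) = 0] shows that a vector fixed by [zeta] is killed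
    by [p], and [p] is a unit in [Z_l]. Hence, on any finite quotient [M_O / P] by a submodule,
    all orbits of [gamma] outside [0] have exactly [p ^ n] elements, and
    [#|M_O / P| = 1] modulo [p ^ n] ([component_quotient_card]). This is applied to
    - [P = l M_O + torsion], where [#|M_O / P| = l ^ a] with [a] the [Z_l]-rank, by
      Nakayama's lemma ([basis_mod_torsion]);
    - [P = l M_O], where [#|M_O / P| = l ^ b] with [b] the [l]-rank;
    - [P = 0] when [M_O] is torsion, hence finite.
    In the third case the factors by which the cardinals grow tend to [1]. In the other two,
    [l ^ a = 1] modulo [p ^ n] makes the order of [l] modulo [p ^ n] divide [a], and the
    [p]-part of this order is unbounded ([dvdn_expn_pred]), so the increments of the ranks tend
    to [0].

    It remains to identify [M(n)] with a finite direct sum of components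
    ([mod_trunc_layers]). Evaluation at a character [w] extends to a ring morphism
    [ev w : Lambda -> K], and an element of [Lambda] is determined by these values, by Fourier
    inversion over each finite abelian group [Gamma_n] ([ev_separates]). So all the
    identities between the idempotents are read off from [ev w (idem O) = 1] if [O w] and
    [0] otherwise ([ev_idem]). That an element with these values exists is where the Galois
    group enters: the Fourier coefficients are fixed by all the automorphisms of [K] over [Z_l],
    so they lie in the fraction field of [Z_l] ([fixed_by_automorphisms], by extending
    partial embeddings with Zorn's lemma), and they are integral. Finally [1] minus the sum of the
    idempotents of level [n] lies in the [n]-th augmentation ideal, so an element of [M]
    killed by all the idempotents is [0], by completeness ([components_separate]). *)

(** * Arithmetic of the p-adic integers *)

(** Typed as a natural number, so that an equation between indices can be
    rewritten in it. *)
Definition residue q (a : padic_int q) (n : nat) : nat := a n.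

Section PadicIntegersTheory.
Variable q : nat.
Hypothesis q_gt1 : (1 < q)%N.
Local Notation Zq := (padic_int q).

Lemma Zp_trunc_pow n : (Zp_trunc (q ^ n.+1)).+2 = (q ^ n.+1)%N.
Proof.
by apply: Zp_cast; rewrite (leq_trans q_gt1) // -{1}(expn1 q) leq_pexp2l // ltnW.
Qed.

Lemma residue_lt (a : Zq) n : (residue a n < q ^ n.+1)%N.
Proof. by rewrite -[X in (_ < X)%N]Zp_trunc_pow ltn_ord. Qed.

Lemma residue_inj (a b : Zq) : residue a =1 residue b -> a = b.
Proof. by move=> E; apply: invlim_ext => n; apply: val_inj; exact: E. Qed.

Lemma residue_red (a : Zq) n : (residue a n.+1 %% q ^ n.+1)%N = residue a n.
Proof.
by have /= := congr1 (@nat_of_ord _) (lim_compP a n); rewrite [X in (_ %% X)%N = _]Zp_trunc_pow.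
Qed.

Lemma residue_redD (a : Zq) k n : (residue a (k + n) %% q ^ n.+1)%N = residue a n.
Proof.
elim: k => [|k IH]; first by rewrite add0n modn_small ?residue_lt.
rewrite -IH addSn -(residue_red a (k + n)) modn_dvdm //.
by rewrite dvdn_exp2l // ltnS leq_addl.
Qed.

Lemma padic_of_residues (u : nat -> nat) :
    (forall n, u n.+1 = u n %[mod q ^ n.+1]) ->
  exists a : Zq, forall n, residue a n = (u n %% q ^ n.+1)%N.
Proof.
move=> u_compat.
pose v n : 'Z_(q ^ n.+1) := inZp (u n).
have vP n : Zpow_red (v n.+1) = v n.
  apply: val_inj; rewrite /= modn_dvdm ?Zpow_red_dvd //.
  by rewrite [X in (_ %% X)%N = _]Zp_trunc_pow [X in _ = (_ %% X)%N]Zp_trunc_pow.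
by exists (InvLim vP) => n; rewrite /residue /= [X in (_ %% X)%N = _]Zp_trunc_pow.
Qed.

Lemma residueD (a b : Zq) n :
  residue (a + b) n = ((residue a n + residue b n) %% q ^ n.+1)%N.
Proof. by rewrite /residue /= [X in (_ %% X)%N = _]Zp_trunc_pow. Qed.

Lemma residueM (a b : Zq) n :
  residue (a * b) n = ((residue a n * residue b n) %% q ^ n.+1)%N.
Proof. by rewrite /residue /= [X in (_ %% X)%N = _]Zp_trunc_pow. Qed.

Lemma residue1 n : residue (1 : Zq) n = (1 %% q ^ n.+1)%N.
Proof. by rewrite /residue /= [X in (_ %% X)%N = _]Zp_trunc_pow. Qed.

Lemma residue_nat k n : residue (k%:R : Zq) n = (k %% q ^ n.+1)%N.
Proof.
elim: k => [|k IH]; first by rewrite mod0n.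
by rewrite mulrS residueD IH residue1 modnDmr modnDml add1n.
Qed.

Lemma padic_dvdP (a : Zq) k :
  residue a k = 0%N -> exists b, a = (q ^ k.+1)%:R * b.
Proof.
move=> ak0; pose u n := (residue a (k.+1 + n) %/ q ^ k.+1)%N.
have uE n : residue a (k.+1 + n) = (u n * q ^ k.+1)%N.
  rewrite /u divnK // /dvdn; have := residue_redD a n.+1 k.
  by rewrite addnC addnS -addSn => ->; rewrite ak0.
have q0 : (0 < q ^ k.+1)%N by rewrite expn_gt0 ltnW.
have [n|b bE] := @padic_of_residues u.
  have := residue_red a (k.+1 + n); rewrite -addnS !uE.
  move/(congr1 (modn^~ (q ^ n.+1 * q ^ k.+1)%N)).
  rewrite modn_dvdm; last by rewrite -expnD addnC.
  by rewrite -!muln_modl => /eqP; rewrite eqn_pmul2r // => /eqP.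
exists b; apply: residue_inj => n.
by rewrite residueM residue_nat bE modnMm mulnC -uE residue_redD.
Qed.

Lemma padic_approx (a : Zq) k :
  exists b, a = (residue a k)%:R + (q ^ k.+1)%:R * b.
Proof.
have [|b bE] := @padic_dvdP (a - (residue a k)%:R) k; last first.
  by exists b; rewrite -bE addrC subrK.
have mE : ((residue a k)%:R : Zq) k = a k :> 'Z_(q ^ k.+1).
  apply: ord_inj; apply: etrans (residue_nat _ _) _.
  by rewrite modn_small ?residue_lt.
have -> : residue (a - (residue a k)%:R) k =
    (a k - ((residue a k)%:R : Zq) k : 'Z_(q ^ k.+1)) by [].
by rewrite mE subrr.
Qed.

Lemma padic_mulq_eq0 (a : Zq) : q%:R * a = 0 -> a = 0.
Proof.
move=> qa0; apply: residue_inj => n; rewrite -residue_red.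
have /(congr1 (@residue q^~ n.+1)) := qa0.
rewrite residueM residue_nat modnMml (expnS q n.+1) -muln_modr => /eqP.
by rewrite muln_eq0 eqn0Ngt ltnW //= => /eqP ->.
Qed.

Lemma padic_mulqX_eq0 k (a : Zq) : (q ^ k)%:R * a = 0 -> a = 0.
Proof.
elim: k => [|k IH]; first by rewrite mul1r.
by rewrite expnS natrM -mulrA => /padic_mulq_eq0/IH.
Qed.

(** Consecutive congruences suffice because the distance is ultrametric. *)
Lemma padic_cvg_step (u : nat -> nat) :
    (forall k, exists N, forall n, (N <= n)%N -> u n.+1 = u n %[mod q ^ k]) ->
  padic_cvg q u.
Proof.
move=> uP; have /choice[N uN] k := uP k.+1.
have stable k n : (N k <= n)%N -> u n = u (N k) %[mod q ^ k.+1].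
  move=> /subnK <-; elim: (n - N k)%N => // d IH.
  by rewrite addSn uN ?IH // leq_addl.
have [k|x xE] := @padic_of_residues (fun k => u (N k)).
  have := stable k (maxn (N k) (N k.+1)) (leq_maxl _ _).
  have /(congr1 (modn^~ (q ^ k.+1)%N)) := stable k.+1 _ (leq_maxr (N k) (N k.+1)).
  by rewrite !modn_dvdm ?dvdn_exp2l // => <- ->.
exists x => k; exists (N k) => n /stable un.
by apply: ord_inj; apply: etrans (residue_nat _ _) _; rewrite un -xE.
Qed.

End PadicIntegersTheory.

Section PadicPrime.
Variable l : nat.
Hypothesis l_prime : prime l.
Let l_gt1 : (1 < l)%N := prime_gt1 l_prime.
Local Notation Zl := (padic_int l).

Lemma padic_unit (a : Zl) : residue a 0 <> 0%N -> exists b, a * b = 1.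
Proof.
move=> a0; have co n : coprime (l ^ n.+1) (residue a n).
  apply: coprimeXl; rewrite prime_coprime //.
  apply/negP => dv; apply: a0; apply/eqP.
  by rewrite -(residue_redD l_gt1 a n 0) addn0 expn1.
have au n : a n \is a GRing.unit.
  by rewrite -[a n]natr_Zp unitZpE ?co // -[X in (_ < X)%N](Zp_trunc_pow l_gt1).
have bP n : Zpow_red (a n.+1)^-1 = (a n)^-1.
  have aE : Zpow_red (a n.+1) = a n := lim_compP a n.
  exact: etrans (rmorphV (@Zpow_red l n) (au n.+1)) (congr1 GRing.inv aE).
by exists (InvLim bP); apply: invlim_ext => n; exact: (mulrV (au n)).
Qed.

Lemma padic_factor (a : Zl) :
  a <> 0 -> exists k u v, a = (l ^ k)%:R * u /\ u * v = 1.
Proof.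
move=> a0; have [n an] : exists n, residue a n != 0%N.
  apply: contrapT => H; apply: a0; apply: residue_inj => n.
  by apply/eqP; apply: contrapT => /negP E; apply: H; exists n.
have {n an} [[|n] an nmin] := ex_minnP (ex_intro (fun n => residue a n != 0%N) n an).
  have [v uv] := padic_unit (elimN eqP an).
  by exists 0%N, a, v; rewrite mul1r.
have an0 : residue a n = 0%N.
  by apply/eqP; apply: contraT => /nmin; rewrite ltnn.
have [b aE] := padic_dvdP l_gt1 an0.
have [|v bv] := @padic_unit b; last by exists n.+1, b, v.
move=> b0; have [c bE] := padic_dvdP l_gt1 b0.
case/eqP: an; rewrite aE bE expn1 mulrA -natrM -expnSr.
by rewrite residueM // residue_nat // modnn mul0n mod0n.
Qed.

Lemma padic_integral (a b : Zl) : a * b = 0 -> a = 0 \/ b = 0.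
Proof.
move=> ab0; have [->|/eqP a0] := eqVneq a 0; [by left|right].
have [k [u [v [aE uv]]]] := padic_factor a0.
move: ab0; rewrite aE -mulrA => /(padic_mulqX_eq0 l_gt1) ub0.
by rewrite -[b]mul1r -uv (mulrC u) -mulrA ub0 mulr0.
Qed.

Lemma padic_nat_unit k : coprime l k -> exists v : Zl, k%:R * v = 1.
Proof.
move=> co; apply: padic_unit; rewrite residue_nat // expn1 => /eqP.
by move: co; rewrite prime_coprime // => /negP.
Qed.

Lemma padic_natr_neq0 k : (0 < k)%N -> (k%:R : Zl) <> 0.
Proof.
move=> k0 /(congr1 (@residue l^~ k)); rewrite residue_nat // modn_small.
  by move/eqP; rewrite eqn0Ngt k0.
by rewrite (ltn_trans (ltn_expl k l_gt1)) // ltn_exp2l.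
Qed.

Variables (K : fieldType) (iota : {rmorphism Zl -> K}).
Hypothesis iota_inj : injective iota.

Lemma iota_eq0 c : iota c = 0 -> c = 0.
Proof. by move=> c0; apply: iota_inj; rewrite c0 rmorph0. Qed.

Lemma iota_natr_neq0 k : (0 < k)%N -> (k%:R : K) != 0.
Proof.
move=> k0; apply/eqP; rewrite -(rmorph_nat iota) => /iota_eq0.
exact: padic_natr_neq0.
Qed.

(** A monic equation for [1 / l], cleared of denominators, reads [1 = 0]
    modulo [l]. *)
Lemma inv_prime_not_integral : ~ integralOver iota (l%:R)^-1.
Proof.
move=> [P mP /eqP rP]; set n := (size P).-1.
have sP : size P = n.+1 by rewrite prednK // size_poly_gt0 monic_neq0.
have l0 : (l%:R : K) != 0 by apply: iota_natr_neq0; exact: ltnW.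
have : \sum_(i < n.+1) P`_i * l%:R ^+ (n - i) = 0.
  apply: iota_eq0; rewrite rmorph_sum -[RHS](mulr0 (l%:R ^+ n)) -[X in _ = _ * X]rP.
  rewrite horner_coef size_map_poly_id0 ?(monicP mP) ?rmorph1 ?oner_neq0 // sP.
  rewrite mulr_sumr; apply: eq_bigr => i _.
  rewrite coef_map /= rmorphM rmorphXn rmorph_nat mulrCA; congr (_ * _).
  by rewrite exprVn expfB_cond // (negbTE l0) add0n -ltnS.
have Pn : P`_n = 1 by rewrite -(monicP mP) lead_coefE.
rewrite big_ord_recr /= subnn Pn mulr1.
suff [b ->] : exists b, \sum_(i < n) P`_i * l%:R ^+ (n - i) = l%:R * b.
  move=> /(congr1 (@residue l^~ 0%N)).
  rewrite residueD // residueM // residue1 // residue_nat // expn1 modnn.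
  by rewrite mul0n mod0n add0n !modn_small.
exists (\sum_(i < n) P`_i * l%:R ^+ (n - i).-1).
rewrite mulr_sumr; apply: eq_bigr => i _.
by rewrite mulrCA -exprS prednK // subn_gt0.
Qed.

(** A fraction of negative valuation is a unit divided by a positive power of [l]; if it were
    integral, so would be [1 / l]. *)
Lemma padic_integrally_closed (a b : Zl) (x : K) :
  a <> 0 -> iota a * x = iota b -> integralOver iota x -> exists c, iota c = x.
Proof.
move=> a0 abx int_x.
have [b0|/eqP b0] := eqVneq b 0.
  exists 0; rewrite rmorph0; apply/esym/eqP; move: abx => /eqP.
  rewrite b0 rmorph0 mulf_eq0 => /orP[/eqP/iota_eq0|//].
  by move/a0.
have [k [u [v [aE uv]]]] := padic_factor a0.
have [j [u' [v' [bE uv']]]] := padic_factor b0.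
have l0 i : (l%:R : K) ^+ i != 0 by rewrite expf_neq0 // iota_natr_neq0 // ltnW.
have {abx} xE : (l%:R : K) ^+ k * x = l%:R ^+ j * iota (u' * v).
  move: abx; rewrite aE bE !rmorphM !rmorph_nat !natrX => abx.
  by rewrite mulrA -abx mulrAC -(mulrA (l%:R ^+ k)) -rmorphM uv rmorph1 mulr1.
have [kj|jk] := leqP k j.
  exists ((l ^ (j - k))%:R * (u' * v)).
  apply: (mulfI (l0 k)); rewrite xE rmorphM rmorph_nat natrX mulrA -exprD.
  by rewrite subnKC.
exfalso; apply: inv_prime_not_integral.
have -> : l%:R^-1 = l%:R ^+ (k - j).-1 * x * iota (v' * u) :> K.
  have xE' : l%:R ^+ (k - j) * x = iota (u' * v).
    by apply: (mulfI (l0 j)); rewrite mulrA -exprD subnKC ?xE // ltnW.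
  have /mulfI : (l%:R : K) != 0 by have := l0 1%N; rewrite expr1.
  apply; rewrite mulfV; last by have := l0 1%N; rewrite expr1.
  rewrite !mulrA -exprS prednK ?subn_gt0 // xE' -rmorphM mulrACA uv' (mulrC v) uv mulr1.
  by rewrite rmorph1.
apply: integral_mul; last exact: integral_id.
apply: integral_mul => //; rewrite -natrX; exact: integral_nat.
Qed.

End PadicPrime.

(** * Finitely generated modules over the l-adic integers *)

Section PadicModules.
Variable l : nat.
Hypothesis l_prime : prime l.
Let l_gt1 : (1 < l)%N := prime_gt1 l_prime.
Local Notation Zl := (padic_int l).
Variable V : lmodType Zl.
Implicit Types (N P : set V) (s : seq V) (x y : V).

Definition submod N : Prop :=
  [/\ N 0, forall x y, N x -> N y -> N (x + y) & forall (c : Zl) x, N x -> N (c *: x)].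

Section Submod.
Variable N : set V.
Hypothesis N_sub : submod N.
Lemma submod0 : N 0. Proof. by case: N_sub. Qed.
Lemma submodD x y : N x -> N y -> N (x + y). Proof. by case: N_sub => _ H _; exact: H. Qed.
Lemma submodZ c x : N x -> N (c *: x). Proof. by case: N_sub => _ _; exact. Qed.
Lemma submodN x : N x -> N (- x). Proof. by rewrite -scaleN1r; exact: submodZ. Qed.
Lemma submodB x y : N x -> N y -> N (x - y).
Proof. by move=> Nx Ny; exact: submodD (submodN Ny). Qed.
Lemma submod_sum (I : Type) (r : seq I) (Q : pred I) (F : I -> V) :
  (forall i, N (F i)) -> N (\sum_(i <- r | Q i) F i).
Proof.
by move=> NF; elim/big_ind: _ => [|x y|i _]; [exact: submod0|exact: submodD|exact: NF].
Qed.
End Submod.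

Definition sum_set (N1 N2 : set V) : set V :=
  [set y | exists y1 y2, [/\ N1 y1, N2 y2 & y = y1 + y2]].

Lemma sum_submod N1 N2 : submod N1 -> submod N2 -> submod (sum_set N1 N2).
Proof.
move=> S1 S2; split.
- by exists 0, 0; split; [exact: submod0|exact: submod0|rewrite addr0].
- move=> _ _ [x1 [x2 [Nx1 Nx2 ->]]] [y1 [y2 [Ny1 Ny2 ->]]].
  exists (x1 + y1), (x2 + y2); split; [exact: submodD|exact: submodD|].
  by rewrite addrACA.
- move=> c _ [x1 [x2 [Nx1 Nx2 ->]]]; exists (c *: x1), (c *: x2).
  by split; [exact: submodZ|exact: submodZ|rewrite scalerDr].
Qed.

(** Defined by recursion on the generators, since they are always added or eliminated
    one at a time. *)
Fixpoint zspan s : set V :=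
  if s is x :: s' then [set y | exists c : Zl, zspan s' (y - c *: x)] else [set 0].

Lemma zspan_submod s : submod (zspan s).
Proof.
elim: s => [|x s IH] /=.
  by split=> // [x y -> ->|c x ->]; rewrite /= ?addr0 ?scaler0.
split; first by exists 0; rewrite scale0r subr0; exact: submod0.
  move=> y z [a ya] [b zb]; exists (a + b).
  by rewrite scalerDl opprD addrACA; exact: submodD.
move=> c y [a ya]; exists (c * a).
by rewrite -scalerA -scalerBr; exact: submodZ.
Qed.

Lemma zspan_mem s x : x \in s -> zspan s x.
Proof.
elim: s => //= y s IH; rewrite inE => /predU1P[->|/IH xs].
  by exists 1; rewrite scale1r subrr; exact: submod0 (zspan_submod s).
by exists 0; rewrite scale0r subr0.
Qed.

Lemma zspan_sub s N : submod N -> (forall x, x \in s -> N x) -> zspan s `<=` N.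
Proof.
move=> N_sub; elim: s => [_ y /= ->|x s IH sN y /= [c yc]]; first exact: submod0.
rewrite -(subrK (c *: x) y); apply: submodD => //.
  by apply: IH yc => z zs; apply: sN; rewrite inE zs orbT.
by apply: submodZ => //; apply: sN; rewrite inE eqxx.
Qed.

(** Nakayama's lemma for the local ring of l-adic integers, by eliminating the
    generators one after the other: [(1 - l c) x] lies in what remains and
    [1 - l c] is a unit. *)
Lemma nakayama N W s : submod N -> submod W -> (forall x, x \in s -> N x) ->
    (forall y, N y -> exists2 w, W w & zspan s (y - w)) ->
    (forall y, N y -> exists w z, [/\ W w, N z & y = w + l%:R *: z]) ->
  N `<=` W.
Proof.
move=> N_sub W_sub; elim: s => [|x s IH] sN gen Wl.
  by move=> y /gen[w Ww /= /eqP]; rewrite subr_eq0 => /eqP ->.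
apply: IH => // [z zs|y Ny]; first by apply: sN; rewrite inE zs orbT.
have Nx : N x by apply: sN; rewrite inE eqxx.
have [w [z [Ww Nz xE]]] := Wl x Nx.
have [w' Ww' [c zc]] := gen z Nz.
have [v uv] : exists v, (1 - l%:R * c) * v = 1.
  apply: padic_unit => //; move: (1 - _) (subrK (l%:R * c) 1) => d dE d0.
  have := congr1 (@residue l^~ 0%N) dE.
  rewrite residueD // d0 residueM // residue_nat // residue1 // expn1 modnn.
  by rewrite mul0n mod0n addn0 mod0n modn_small.
have xs : exists2 w, W w & zspan s (x - w).
  exists (v *: (w + l%:R *: w')).
    by apply: submodZ => //; apply: submodD => //; exact: submodZ.
  have -> : x - v *: (w + l%:R *: w') = v *: (l%:R *: (z - w' - c *: x)).
    have xv : x = v *: ((1 - l%:R * c) *: x) by rewrite scalerA mulrC uv scale1r.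
    rewrite {1}xv -scalerBr; congr (_ *: _).
    rewrite scalerBl scale1r {1}xE !scalerBr -scalerA (addrC w) opprD addrA.
    by rewrite -(addrA (l%:R *: z)) (addrC w) addrA addrK addrAC.
  by do 2!apply: (submodZ (zspan_submod s)).
have [w1 Ww1 [a ya]] := gen y Ny; have [w2 Ww2 xw2] := xs.
exists (w1 + a *: w2); first by apply: submodD => //; exact: submodZ.
have -> : y - (w1 + a *: w2) = (y - w1 - a *: x) + a *: (x - w2).
  by rewrite scalerBr addrA subrK opprD addrA.
apply: submodD => //; first exact: zspan_submod.
by apply: submodZ => //; exact: zspan_submod.
Qed.

(** * Bases of residual quotients *)

(** When [P] contains [l N], this says that [x] lifts a basis of the vector space [N / P] over
    the field with [l] elements. *)
Definition basis_mod N P r (x : 'I_r -> V) : Prop :=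
  [/\ forall i, N (x i),
      forall y, N y -> exists c : 'I_r -> Zl, P (y - \sum_i c i *: x i) &
      forall c : 'I_r -> Zl, P (\sum_i c i *: x i) -> forall i, residue (c i) 0 = 0%N].

Lemma span_mod_submod P r (x : 'I_r -> V) : submod P ->
  submod [set y | exists c : 'I_r -> Zl, P (y - \sum_i c i *: x i)].
Proof.
move=> P_sub; split.
- exists (fun _ => 0); rewrite sub0r big1 ?oppr0 => [|i _]; last by rewrite scale0r.
  exact: submod0.
- move=> y z [c yc] [d zd]; exists (fun i => c i + d i).
  under eq_bigr do rewrite scalerDl.
  by rewrite big_split opprD addrACA; exact: submodD.
- move=> a y [c yc]; exists (fun i => a * c i).
  under eq_bigr do rewrite -scalerA.
  by rewrite -scaler_sumr -scalerBr; exact: submodZ.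
Qed.

(** A generator outside the span of the previous ones modulo [P] is independent of
    them: in a relation its coefficient cannot be a unit, hence is divisible by [l]. *)
Lemma basis_mod_exists N P s : submod N -> submod P -> (forall y, N y -> P (l%:R *: y)) ->
  (forall x, x \in s -> N x) -> N `<=` zspan s -> exists r (x : 'I_r -> V), basis_mod N P x.
Proof.
move=> N_sub P_sub lNP sN Ns.
suff [r [x [Nx sx indx]]] : exists r (x : 'I_r -> V), [/\ forall i, N (x i),
      forall y, zspan s y -> exists c : 'I_r -> Zl, P (y - \sum_i c i *: x i) &
      forall c : 'I_r -> Zl, P (\sum_i c i *: x i) -> forall i, residue (c i) 0 = 0%N].
  by exists r, x; split=> // y /Ns; exact: sx.
elim: s sN {Ns} => [_|x0 s IH sN].
  exists 0%N, (fun=> 0); split=> [[]|y /= ->|c _ []] //.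
  by exists (fun=> 0); rewrite big_ord0 subrr; exact: submod0.
have [z zs|r [x [Nx sx indx]]] := IH; first by apply: sN; rewrite inE zs orbT.
have Nx0 : N x0 by apply: sN; rewrite inE eqxx.
have [x0x|x0x] := pselect (exists c : 'I_r -> Zl, P (x0 - \sum_i c i *: x i)).
  exists r, x; split=> // y [a /sx ya]; have Q_sub := span_mod_submod x P_sub.
  by rewrite -(subrK (a *: x0) y); apply: (submodD Q_sub ya); exact: (submodZ Q_sub a x0x).
pose x' i := if unlift ord0 i is Some j then x j else x0.
have sumE (c : 'I_r.+1 -> Zl) :
    \sum_i c i *: x' i = c ord0 *: x0 + \sum_i c (lift ord0 i) *: x i.
  rewrite big_ord_recl /x' unlift_none; congr (_ + _).
  by apply: eq_bigr => i _; rewrite liftK.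
exists r.+1, x'; split.
- by move=> i; rewrite /x'; case: unlift.
- move=> y [a /sx[c yc]].
  exists (fun i => if unlift ord0 i is Some j then c j else a).
  rewrite sumE unlift_none; under eq_bigr do rewrite liftK.
  by rewrite opprD addrA.
- move=> c Pc.
  have c0 : residue (c ord0) 0 = 0%N.
    apply: contrapT => /(padic_unit l_prime)[v cv]; apply: x0x.
    exists (fun i => - (v * c (lift ord0 i))).
    have := submodZ P_sub v Pc; rewrite sumE scalerDr scalerA mulrC cv scale1r.
    congr (P (_ + _)); rewrite scaler_sumr -sumrN; apply: eq_bigr => i _.
    by rewrite scaleNr opprK scalerA.
  move=> i; case: (unliftP ord0 i) => [j ->|-> //].
  apply: (indx (fun j => c (lift ord0 j))).
  have [b bE] := padic_dvdP l_gt1 c0.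
  rewrite -(addKr (c ord0 *: x0) (\sum_i _)) -sumE addrC; apply: submodB => //.
  by rewrite bE expn1 -scalerA; apply: lNP; exact: submodZ.
Qed.

Lemma basis_mod_sum N1 P1 r1 (x1 : 'I_r1 -> V) N2 P2 r2 (x2 : 'I_r2 -> V) :
    submod N1 -> submod P1 -> submod N2 -> submod P2 ->
    P1 `<=` N1 -> P2 `<=` N2 -> (forall y, N1 y -> N2 y -> y = 0) ->
    basis_mod N1 P1 x1 -> basis_mod N2 P2 x2 ->
  basis_mod (sum_set N1 N2) (sum_set P1 P2)
    (fun i : 'I_(r1 + r2) => match fintype.split i with inl j => x1 j | inr j => x2 j end).
Proof.
move=> N1_sub P1_sub N2_sub P2_sub PN1 PN2 disj [Nx1 gen1 ind1] [Nx2 gen2 ind2].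
set x := (fun i : 'I_(r1 + r2) => _).
have sumE (c : 'I_(r1 + r2) -> Zl) : \sum_i c i *: x i =
    \sum_i c (lshift r2 i) *: x1 i + \sum_i c (rshift r1 i) *: x2 i.
  rewrite big_split_ord /x; congr (_ + _); apply: eq_bigr => i _.
    by rewrite (fintype.unsplitK (inl i)).
  by rewrite (fintype.unsplitK (inr i)).
split.
- move=> i; rewrite /x; case: (fintype.split i) => j.
    by exists (x1 j), 0; split; [exact: Nx1|exact: submod0|rewrite addr0].
  by exists 0, (x2 j); split; [exact: submod0|exact: Nx2|rewrite add0r].
- move=> _ [y1 [y2 [/gen1[c1 Py1] /gen2[c2 Py2] ->]]].
  exists (fun i => match fintype.split i with inl j => c1 j | inr j => c2 j end).
  rewrite sumE; under eq_bigr do rewrite (fintype.unsplitK (inl _)).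
  under [X in _ - (_ + X)]eq_bigr do rewrite (fintype.unsplitK (inr _)).
  by rewrite opprD addrACA; eexists; eexists; split; [exact: Py1|exact: Py2|].
- move=> c [z1 [z2 [Pz1 Pz2]]]; rewrite sumE.
  set t1 := \sum_i _ *: x1 i; set t2 := \sum_i _ *: x2 i => tE.
  have Nt1 : N1 t1 by apply: submod_sum => // i; exact: submodZ.
  have Nt2 : N2 t2 by apply: submod_sum => // i; exact: submodZ.
  have E : t1 - z1 = z2 - t2 by apply/eqP; rewrite subr_eq addrAC eq_sym subr_eq tE addrC.
  have t1z1 : t1 - z1 = 0.
    apply: disj; first by apply: submodB => //; exact: PN1.
    by rewrite E; apply: submodB => //; exact: PN2.
  have Pt1 : P1 t1 by rewrite -(subrK z1 t1) t1z1 add0r.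
  have Pt2 : P2 t2 by move: E; rewrite t1z1 => /esym/eqP; rewrite subr_eq0 => /eqP <-.
  move=> i; rewrite -(fintype.splitK i); case: (fintype.split i) => j /=.
    exact: (ind1 (fun j => c (lshift r2 j))).
  exact: (ind2 (fun j => c (rshift r1 j))).
Qed.

End PadicModules.

Section PadicRanks.
Variable l : nat.
Hypothesis l_prime : prime l.
Let l_gt1 : (1 < l)%N := prime_gt1 l_prime.
Local Notation Zl := (padic_int l).
Variable V : lmodType Zl.
Implicit Types (N P : set V) (s : seq V) (x y : V).

Definition lmul_set N : set V := [set y *+ l | y in N].

Definition torsion_part N : set V := [set y | N y /\ exists k, (l ^ k)%:R *: y = 0 :> V].

(** The kernel of [N -> (N / torsion) / l]. *)
Definition lmul_torsion N : set V := sum_set (lmul_set N) (torsion_part N).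

Lemma lmul_setP N y : N y -> lmul_set N ((l%:R : Zl) *: y).
Proof. by move=> Ny; exists y => //; rewrite scaler_nat. Qed.

Lemma lmul_submod N : submod N -> submod (lmul_set N).
Proof.
move=> N_sub; split.
- by exists 0; [exact: submod0|rewrite mul0rn].
- move=> _ _ [x Nx <-] [y Ny <-]; exists (x + y); first exact: submodD.
  by rewrite mulrnDl.
- move=> c _ [x Nx <-]; exists (c *: x); first exact: submodZ.
  by rewrite scalerMnr.
Qed.

Lemma torsion_submod N : submod N -> submod (torsion_part N).
Proof.
move=> N_sub; split.
- by split; [exact: submod0|exists 0%N; rewrite scaler0].
- move=> x y [Nx [a xa]] [Ny [b yb]]; split; first exact: submodD.
  exists (a + b)%N; rewrite expnD natrM scalerDr {1}mulrC -!scalerA xa yb.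
  by rewrite !scaler0 addr0.
- move=> c x [Nx [a xa]]; split; first exact: submodZ.
  by exists a; rewrite scalerA mulrC -scalerA xa scaler0.
Qed.

Lemma lmul_torsion_submod N : submod N -> submod (lmul_torsion N).
Proof.
by move=> N_sub; apply: sum_submod; [exact: lmul_submod|exact: torsion_submod].
Qed.

Lemma lmul_sub N : submod N -> lmul_set N `<=` N.
Proof.
by move=> N_sub _ [y Ny <-]; rewrite -(scaler_nat l y); exact: submodZ.
Qed.

Lemma lmul_torsion_sub N : submod N -> lmul_torsion N `<=` N.
Proof.
move=> N_sub _ [y [z [/(lmul_sub N_sub) Ny [Nz _] ->]]]; exact: submodD.
Qed.

Lemma lmul_sum N1 N2 : lmul_set (sum_set N1 N2) = sum_set (lmul_set N1) (lmul_set N2).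
Proof.
apply/seteqP; split=> [_ [_ [y1 [y2 [N1y N2y ->]]] <-]|_ [_ [_ [[y1 N1y <-] [y2 N2y <-] ->]]]].
  exists (y1 *+ l), (y2 *+ l); rewrite mulrnDl.
  by split=> //; [exists y1|exists y2].
by exists (y1 + y2); [exists y1, y2|rewrite mulrnDl].
Qed.

Lemma torsion_sum N1 N2 : submod N1 -> submod N2 ->
    (forall y, N1 y -> N2 y -> y = 0) ->
  torsion_part (sum_set N1 N2) = sum_set (torsion_part N1) (torsion_part N2).
Proof.
move=> N1_sub N2_sub disj; apply/seteqP; split.
  move=> _ [[y1 [y2 [N1y N2y ->]]] [k]]; rewrite scalerDr => /eqP.
  rewrite addr_eq0 => /eqP E.
  have y1k : (l ^ k)%:R *: y1 = 0.
    by apply: disj; [exact: submodZ|rewrite E; apply: submodN => //; exact: submodZ].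
  exists y1, y2; split=> //; split=> //; exists k => //.
  by move: E; rewrite y1k => /esym/eqP; rewrite oppr_eq0 => /eqP.
move=> _ [y1 [y2 [[N1y [a y1a]] [N2y [b y2b]] ->]]]; split; first by exists y1, y2.
exists (a + b)%N; rewrite expnD natrM scalerDr {1}mulrC -!scalerA y1a y2b.
by rewrite !scaler0 addr0.
Qed.

Lemma lmul_torsion_sum N1 N2 : submod N1 -> submod N2 ->
    (forall y, N1 y -> N2 y -> y = 0) ->
  lmul_torsion (sum_set N1 N2) = sum_set (lmul_torsion N1) (lmul_torsion N2).
Proof.
move=> N1_sub N2_sub disj; rewrite /lmul_torsion lmul_sum torsion_sum //.
apply/seteqP; split=> _ [_ [_ [[a [b [Ha Hb ->]]] [c [d [Hc Hd ->]]] ->]]].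
  by exists (a + c), (b + d); split; [exists a, c|exists b, d|rewrite addrACA].
by exists (a + c), (b + d); split; [exists a, c|exists b, d|rewrite addrACA].
Qed.

(** By Nakayama's lemma, a lift of a basis of [(N / torsion) / l] is a basis of
    [N / torsion]. *)
Lemma basis_mod_torsion N s r (x : 'I_r -> V) :
    submod N -> (forall y, y \in s -> N y) -> N `<=` zspan s ->
    basis_mod N (lmul_torsion N) x ->
  (forall c : 'I_r -> Zl, \sum_i c i *: x i = 0 -> forall i, c i = 0) /\
  (forall y, N y -> exists (c : 'I_r -> Zl) k, (l ^ k)%:R *: (y - \sum_i c i *: x i) = 0).
Proof.
move=> N_sub sN Ns [Nx gen ind]; have T_sub := torsion_submod N_sub.
split; last first.
  suff NW : N `<=` [set y | exists c : 'I_r -> Zl, torsion_part N (y - \sum_i c i *: x i)].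
    by move=> y /NW[c [_ [k ?]]]; exists c, k.
  apply: (nakayama l_prime N_sub (span_mod_submod x T_sub) sN).
    move=> y /Ns; exists 0; last by rewrite subr0.
    by exists (fun=> 0); rewrite big1 ?subr0 => [|i _]; [exact: submod0|rewrite scale0r].
  move=> y Ny; have [c [_ [t [[z Nz <-] Tt E]]]] := gen y Ny.
  exists (\sum_i c i *: x i + t), z; split=> //.
    by exists c; rewrite addrC addKr.
  by rewrite -{1}(subrK (\sum_i c i *: x i) y) E scaler_nat addrC (addrC (z *+ l)) addrA.
(* A relation forces all its coefficients to be divisible by [l]; dividing by [l] leaves
   a relation modulo torsion, so they are divisible by every power of [l]. *)
suff H k : forall c : 'I_r -> Zl, torsion_part N (\sum_i c i *: x i) ->
    forall i, residue (c i) k = 0%N.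
  move=> c c0 i; apply: residue_inj => k.
  by rewrite (H k) // c0; exact: submod0.
elim: k => [|k IH] c Tc.
  apply: ind; exists 0, (\sum_i c i *: x i).
  by split; [exact: submod0 (lmul_submod N_sub)|exact: Tc|rewrite add0r].
have /choice[d dE] : forall i, exists d, c i = l%:R * d.
  move=> i; have [|d] := @padic_dvdP _ l_gt1 (c i) 0; last by rewrite expn1; exists d.
  apply: ind; exists 0, (\sum_i c i *: x i).
  by split; [exact: submod0 (lmul_submod N_sub)|exact: Tc|rewrite add0r].
move=> i; rewrite dE.
have /(padic_dvdP l_gt1)[b ->] : residue (d i) k = 0%N.
  apply: IH; case: Tc => _ [j cj]; split.
    by apply: submod_sum => // i'; exact: submodZ.
  exists j.+1; rewrite expnSr natrM -scalerA scaler_sumr -[RHS]cj; congr (_ *: _).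
  by apply: eq_bigr => i' _; rewrite scalerA dE.
by rewrite mulrA -natrM -expnS residueM // residue_nat // modnn mul0n mod0n.
Qed.

(** Gaussian elimination without division: a nonzero entry [a] of the first column
    clears that column in the other rows, after their multiplication by [a]. *)
Lemma left_kernel r (B : 'I_r.+1 -> 'I_r -> Zl) : exists d : 'I_r.+1 -> Zl,
  (exists j, d j <> 0) /\ forall i, \sum_j d j * B j i = 0.
Proof.
elim: r => [|r IH] in B *.
  by exists (fun=> 1); split=> [|[] //]; exists ord0; apply/eqP; exact: oner_neq0.
have [[j0 a0]|B0] := pselect (exists j, B j ord0 <> 0); last first.
  have [d [[j dj] dB]] := IH (fun j i => B (lift ord0 j) (lift ord0 i)).
  exists (fun j => if unlift ord0 j is Some j' then d j' else 0); split.
    by exists (lift ord0 j); rewrite liftK.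
  move=> i; rewrite big_ord_recl unlift_none mul0r add0r.
  under eq_bigr do rewrite liftK.
  case: (unliftP ord0 i) => [i' ->|->]; first exact: dB.
  rewrite big1 // => j' _; rewrite (_ : B _ _ = 0) ?mulr0 //.
  by apply: contrapT => ?; apply: B0; exists (lift ord0 j').
set a := B j0 ord0 in a0.
have [d [[j dj] dB]] := IH (fun j i => a * B (lift j0 j) (lift ord0 i)
                                    - B (lift j0 j) ord0 * B j0 (lift ord0 i)).
exists (fun j => if unlift j0 j is Some j' then a * d j'
                 else - \sum_j' d j' * B (lift j0 j') ord0); split.
  exists (lift j0 j); rewrite liftK => /(padic_integral l_prime)[/a0|/dj] //.
move=> i; rewrite (bigD1_ord j0) //= unlift_none.
under [X in _ + X]eq_bigr do rewrite liftK.
rewrite mulNr mulr_suml -sumrN -big_split /=.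
case: (unliftP ord0 i) => [i' ->|->].
  rewrite -[RHS](dB i'); apply: eq_bigr => j' _.
  by rewrite mulrBr addrC !mulrA (mulrC a).
by rewrite big1 // => j' _; rewrite -/a addrC (mulrC a) mulrAC subrr.
Qed.

Lemma dependent_of_span r (x : 'I_r -> V) (y : 'I_r.+1 -> V) :
    (forall j, exists (c : 'I_r -> Zl) k, (l ^ k)%:R *: (y j - \sum_i c i *: x i) = 0) ->
  exists d : 'I_r.+1 -> Zl, (exists j, d j <> 0) /\ \sum_j d j *: y j = 0.
Proof.
move=> /choice[c /choice[k ck]].
have yE j : (l ^ k j)%:R *: y j = \sum_i ((l ^ k j)%:R * c j i) *: x i.
  apply/eqP; rewrite -subr_eq0 -[X in _ - X == _](_ : (l ^ k j)%:R *: \sum_i c j i *: x i = _).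
    by rewrite -scalerBr ck.
  by rewrite scaler_sumr; apply: eq_bigr => i _; rewrite scalerA.
have [d [[j dj] dB]] := left_kernel (fun j i => (l ^ k j)%:R * c j i).
exists (fun j => d j * (l ^ k j)%:R); split.
  exists j => /(padic_integral l_prime)[//|].
  by apply: padic_natr_neq0 => //; rewrite expn_gt0 ltnW.
under eq_bigr do rewrite -scalerA yE scaler_sumr.
rewrite exchange_big big1 // => i _.
under eq_bigr do rewrite scalerA.
by rewrite -scaler_suml dB scale0r.
Qed.

Lemma basis_mod_repr N P r (x : 'I_r -> V) : submod N -> submod P ->
    (forall y, N y -> P ((l%:R : Zl) *: y)) -> basis_mod N P x ->
  exists rep : {ffun 'I_r -> 'I_l} -> V, [/\ forall t, N (rep t),
    forall y, N y -> exists t, P (y - rep t) &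
    forall t t', P (rep t - rep t') -> t = t'].
Proof.
move=> N_sub P_sub lNP [Nx gen ind].
exists (fun t : {ffun 'I_r -> 'I_l} => \sum_i (t i)%:R *: x i); split.
- by move=> t; apply: submod_sum => // i; exact: submodZ.
- move=> y /gen[c yc].
  have lt_c i : (residue (c i) 0 < l)%N by rewrite -[X in (_ < X)%N]expn1 residue_lt.
  exists [ffun i => Ordinal (lt_c i)].
  rewrite -(subrK (\sum_i c i *: x i) y) -addrA; apply: submodD => //.
  rewrite -sumrB; apply: submod_sum => // i; rewrite ffunE -scalerBl.
  have [b {1}->] := padic_approx l_gt1 (c i) 0.
  by rewrite /= addrC addKr expn1 -scalerA; apply: lNP; exact: submodZ.
- move=> t t'; rewrite -sumrB; under eq_bigr do rewrite -scalerBl.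
  move=> /(ind (fun i => (t i)%:R - (t' i)%:R)) tt'; apply/ffunP => i; apply: val_inj.
  have := congr1 (@residue l^~ 0%N) (subrK (t' i)%:R ((t i)%:R : Zl)).
  by rewrite residueD // tt' add0n !residue_nat // expn1 modn_mod !modn_small.
Qed.

(** If [l ^ k] is the least power of [l] that brings the new generator [x] into the
    span [S] of the others, the elements [a x + y] with [a < l ^ k] and [y] in [S] are pairwise
    distinct: a difference [a - a'] is a unit times a smaller power of [l]. *)
Lemma zspan_torsion_finite s :
    (forall x, x \in s -> exists k, (l ^ k)%:R *: x = 0) ->
  exists t : seq V, [/\ uniq t, forall y, zspan s y <-> y \in t & exists j, size t = (l ^ j)%N].
Proof.
elim: s => [_|x s IH tors_s].
  exists [:: 0]; split=> //; last by exists 0%N.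
  by move=> y /=; rewrite inE; split=> /eqP.
have [z zs|t [t_uniq tP [j tj]]] := IH; first by apply: tors_s; rewrite inE zs orbT.
have ex_k : exists k, `[<zspan s ((l ^ k)%:R *: x)>].
  have [|k xk] := tors_s x; first by rewrite inE eqxx.
  by exists k; apply/asboolP; rewrite xk; exact: submod0 (zspan_submod s).
have [k /asboolP xk kmin] := ex_minnP ex_k.
have S_sub := zspan_submod s.
exists [seq (a%:R : Zl) *: x + y | a <- iota 0 (l ^ k), y <- t]; split.
- apply: allpairs_uniq => //; first exact: iota_uniq.
  move=> _ _ /allpairsP[[a y] [/= + yt ->]] /allpairsP[[a' y'] [/= + y't ->]] /=.
  rewrite !mem_iota !add0n => /andP[_ lt_a] /andP[_ lt_a'] E.
  suff aa' : (a%:R : Zl) - a'%:R = 0.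
    have eq_a : a = a'.
      move/eqP: aa'; rewrite subr_eq0 => /eqP/(congr1 (@residue l^~ k)).
      have lt b : (b < l ^ k)%N -> (b < l ^ k.+1)%N.
        by move=> lt_b; rewrite (leq_trans lt_b) // leq_exp2l.
      by rewrite !residue_nat // !modn_small ?lt.
    by move: E; rewrite eq_a => /addrI ->.
  apply: contrapT => /(padic_factor l_prime)[i [u [v [dE uv]]]].
  have lt_ik : (i < k)%N.
    rewrite ltnNge; apply/negP => le_ki.
    have : (a%:R : Zl) = a'%:R.
      have aE : (a%:R : Zl) = (l ^ k)%:R * ((l ^ (i - k))%:R * u) + a'%:R.
        by rewrite mulrA -natrM -expnD subnKC // -dE subrK.
      have /(congr1 (modn^~ (l ^ k)%N)) := congr1 (@residue l^~ k) aE.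
      have dv : (l ^ k %| l ^ k.+1)%N by rewrite dvdn_exp2l.
      rewrite residueD // residueM // !residue_nat // !modn_dvdm // -modnDm.
      rewrite !modn_dvdm // -modnMml modn_dvdm // modnn mul0n mod0n add0n modn_mod.
      by rewrite !modn_small // => ->.
    move=> aa'; move: dE; rewrite aa' subrr => /esym.
    move=> /(padic_mulqX_eq0 l_gt1) u0; move: uv; rewrite u0 mul0r => /eqP.
    by rewrite eq_sym oner_eq0.
  have : (k <= i)%N; last by rewrite leqNgt lt_ik.
  apply: kmin; apply/asboolP.
  have -> : (l ^ i)%:R *: x = v *: (y' - y).
    have -> : y' - y = (a%:R - a'%:R) *: x.
      by apply/eqP; rewrite scalerBl subr_eq addrAC eq_sym subr_eq E addrC.
    by rewrite dE scalerA mulrCA (mulrC v) uv mulr1.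
  by apply: submodZ => //; apply: submodB => //; apply/tP.
- move=> y; split.
    move=> [c yc]; have [b cE] := padic_approx l_gt1 c k.
    set r := residue c k in cE; apply/allpairsP; exists ((r %% l ^ k)%N, y - (r %% l ^ k)%:R *: x).
    split=> /=; last by rewrite addrC subrK.
      by rewrite mem_iota add0n /= ltn_mod expn_gt0 ltnW.
    have {}cE : c = (r %% l ^ k)%:R + ((r %/ l ^ k)%:R + l%:R * b) * (l ^ k)%:R.
      rewrite cE {1}(divn_eq r (l ^ k)) natrD natrM mulrDl expnS natrM.
      by rewrite (addrC (_ * _) (_%:R)) -addrA (mulrAC l%:R b).
    apply/tP; have -> : y - (r %% l ^ k)%:R *: x =
        (y - c *: x) + ((r %/ l ^ k)%:R + l%:R * b) *: ((l ^ k)%:R *: x).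
      by rewrite cE scalerA scalerDl opprD addrA subrK.
    by apply: submodD => //; exact: submodZ.
  move=> /allpairsP[[a z] [_ /= /tP zs ->]].
  by exists a%:R; rewrite addrC addKr.
- exists (k + j)%N.
  by rewrite size_allpairs size_iota tj expnD.
Qed.

End PadicRanks.

(** * Galois descent to the fraction field *)

Section Automorphisms.
Variables (A : comNzRingType) (K : closedFieldType) (iota : {rmorphism A -> K}).
Hypothesis iota_inj : injective iota.
Hypothesis iota_alg :
  forall x : K, exists2 q : {poly A}, q != 0 & root (map_poly iota q) x.

(** The graphs of the ring morphisms to [K] from a subring of [K] containing the
    fractions of [A], which fix these fractions. For graphs, the upper bound of a chain is
    its union. *)
Definition partial_morphism (S : set (K * K)) : Prop :=
  [/\ forall a b, b <> 0 -> S (iota a / iota b, iota a / iota b),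
      forall u v, S u -> S v -> S (u.1 - v.1, u.2 - v.2),
      forall u v, S u -> S v -> S (u.1 * v.1, u.2 * v.2) &
      forall y, S (0, y) -> y = 0].

Lemma iota_neq0 a : a <> 0 -> iota a != 0.
Proof. by move=> a0; apply/eqP; rewrite -[RHS](rmorph0 iota) => /iota_inj. Qed.

Section Extension.
Variable S : set (K * K).
Hypothesis S_morph : partial_morphism S.

Lemma pm_iota a : S (iota a, iota a).
Proof.
have [Sf _ _ _] := S_morph; have := Sf a 1.
by rewrite rmorph1 divr1; apply; apply/eqP; exact: oner_neq0.
Qed.
Lemma pm0 : S (0, 0). Proof. by have := pm_iota 0; rewrite rmorph0. Qed.
Lemma pm1 : S (1, 1). Proof. by have := pm_iota 1; rewrite rmorph1. Qed.

Lemma pmB u v : S u -> S v -> S (u.1 - v.1, u.2 - v.2).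
Proof. by case: S_morph => _ SB _ _; exact: SB. Qed.
Lemma pmM u v : S u -> S v -> S (u.1 * v.1, u.2 * v.2).
Proof. by case: S_morph => _ _ SM _; exact: SM. Qed.
Lemma pmN u : S u -> S (- u.1, - u.2).
Proof. by move=> Su; have := pmB pm0 Su; rewrite /= !sub0r. Qed.
Lemma pmD u v : S u -> S v -> S (u.1 + v.1, u.2 + v.2).
Proof. by move=> Su /pmN Sv; have := pmB Su Sv; rewrite /= !opprK. Qed.

Lemma pm_sum n (F G : 'I_n -> K) :
  (forall i, S (F i, G i)) -> S (\sum_i F i, \sum_i G i).
Proof.
move=> SFG; elim/big_ind2: _ => [|a b c d Sab Scd|i _]; first exact: pm0.
  exact: (pmD Sab Scd).
exact: SFG.
Qed.

Lemma pmMn u n : S u -> S (u.1 *+ n, u.2 *+ n).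
Proof.
move=> Su; elim: n => [|n IH]; first by rewrite !mulr0n; exact: pm0.
by rewrite !mulrS; exact: pmD Su IH.
Qed.

Lemma pm_horner (g : {poly A}) u :
  S u -> S ((map_poly iota g).[u.1], (map_poly iota g).[u.2]).
Proof.
move=> Su; elim/poly_ind: g => [|g c IH]; first by rewrite rmorph0 !horner0; exact: pm0.
rewrite rmorphD rmorphM /= map_polyX map_polyC !hornerMXaddC.
exact: pmD (pmM IH Su) (pm_iota c).
Qed.

Lemma algebraic_neq0 x : x != 0 ->
  exists g c, c <> 0 /\ (map_poly iota g).[x] * x + iota c = 0.
Proof.
move=> x0; have [q] := iota_alg x.
elim/poly_ind: q => [|g c IH]; first by rewrite eqxx.
rewrite /root rmorphD rmorphM /= map_polyX map_polyC hornerMXaddC => gc /eqP E.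
have [c0|/eqP c0] := eqVneq c 0; last by exists g, c.
move: gc E; rewrite c0 polyC0 raddf0 !addr0 => gX /eqP; rewrite mulf_eq0 (negbTE x0) orbF => gx.
by apply: IH => //; apply: contraNneq gX => ->; rewrite mul0r.
Qed.

(** The inverse of an algebraic element is a polynomial in this element with fractions
    as coefficients. *)
Lemma pm_inv u : S u -> u.1 != 0 ->
  exists2 v, S v & v.1 * u.1 = 1 /\ v.2 * u.2 = 1.
Proof.
move=> Su /algebraic_neq0[g [c [c0 E]]].
have Sc : S ((iota c)^-1, (iota c)^-1).
  by have [Sf _ _ _] := S_morph; have := Sf 1 c c0; rewrite rmorph1 !mul1r.
have Sv := pmM (pmN (pm_horner g Su)) Sc.
eexists; first exact: Sv.
have v1 : - (map_poly iota g).[u.1] * (iota c)^-1 * u.1 = 1.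
  apply: (mulIf (iota_neq0 c0)); rewrite mul1r mulrAC mulfVK ?iota_neq0 //.
  by rewrite mulNr; apply/eqP; rewrite eq_sym -addr_eq0 addrC E.
split; rewrite /= ?v1 //; apply/eqP; rewrite -subr_eq0; apply/eqP.
have [_ _ _ S0] := S_morph; apply: S0.
by have := pmB (pmM Sv Su) pm1; rewrite /= v1 subrr.
Qed.

Lemma pm_eq0 u : S u -> (u.1 == 0) = (u.2 == 0).
Proof.
move=> Su; have [u0|/(pm_inv Su)[v _ [_ E]]] := eqVneq u.1 0.
  have [_ _ _ S0] := S_morph; apply/esym/eqP/S0.
  by rewrite -u0 -surjective_pairing.
by apply/esym/negbTE/eqP => u0; move: E; rewrite u0 mulr0 => /eqP; rewrite eq_sym oner_eq0.
Qed.

Definition pm_poly (p q : {poly K}) : Prop := forall i, S (p`_i, q`_i).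

Lemma pm_polyB p q p' q' : pm_poly p q -> pm_poly p' q' -> pm_poly (p - p') (q - q').
Proof. by move=> H H' i; rewrite !coefB; exact: pmB (H i) (H' i). Qed.

Lemma pm_polyM p q p' q' : pm_poly p q -> pm_poly p' q' -> pm_poly (p * p') (q * q').
Proof.
move=> H H' i; rewrite !coefM; apply: pm_sum => j; exact: pmM (H j) (H' _).
Qed.

Lemma pm_polyC u : S u -> pm_poly u.1%:P u.2%:P.
Proof.
by case: u => a b Su i; rewrite !coefC; case: ifP => // _; exact: pm0.
Qed.

Lemma pm_polyXn k : pm_poly 'X^k 'X^k.
Proof. by move=> i; rewrite !coefXn; case: eqP => _; [exact: pm1|exact: pm0]. Qed.

Lemma pm_size p q : pm_poly p q -> size p = size q.
Proof.
move=> H; apply/eqP; rewrite eqn_leq; apply/andP; split; apply/leq_sizeP => i le_i.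
  by apply/eqP; rewrite (pm_eq0 (H i)) /= nth_default.
by apply/eqP; rewrite -(pm_eq0 (H i)) /= nth_default.
Qed.

Variables (x y : K) (p0 q0 : {poly K}).
Hypothesis pq0 : pm_poly p0 q0.
Hypothesis p0_neq0 : p0 != 0.
Hypothesis p0x : p0.[x] = 0.
Hypothesis p0_min : forall p q, pm_poly p q -> p != 0 -> p.[x] = 0 ->
  (size p0 <= size p)%N.
Hypothesis q0y : q0.[y] = 0.

(** Division by the minimal polynomial, carried out on both sides at once. *)
Lemma pm_root_transfer p q : pm_poly p q -> p.[x] = 0 -> q.[y] = 0.
Proof.
have [n] := ubnP (size p); elim: n => // n IH in p q *; rewrite ltnS => le_n pq px.
have [p00|p_neq0] := eqVneq p 0.
  have /eqP := pm_size pq; rewrite p00 size_poly0 eq_sym size_poly_eq0 => /eqP ->.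
  by rewrite horner0.
have le0 := p0_min pq p_neq0 px.
set d := (size p0).-1; set e := (size p).-1.
have [|v Sv [v1 v2]] := pm_inv (pq0 d); first by rewrite lead_coef_eq0.
pose u := (p`_e * v.1, q`_e * v.2); have Su : S u := pmM (pq e) Sv.
pose p1 := p - u.1%:P * (p0 * 'X^(e - d)); pose q1 := q - u.2%:P * (q0 * 'X^(e - d)).
have pq1 : pm_poly p1 q1.
  exact: pm_polyB (pm_polyM (pm_polyC Su) (pm_polyM pq0 (pm_polyXn _))).
have sp : size p = e.+1 by rewrite prednK // size_poly_gt0.
have sp0 : size p0 = d.+1 by rewrite prednK // size_poly_gt0.
have le_de : (d <= e)%N by rewrite -ltnS -sp -sp0.
have lt1 : (size p1 < size p)%N.
  rewrite sp ltnS; apply/leq_sizeP => i; rewrite leq_eqVlt => /orP[/eqP <-|lt_ei].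
    rewrite coefB coefCM coefMXn ltnNge leq_subr /= subKn //.
    by rewrite -mulrA v1 mulr1 subrr.
  rewrite coefB coefCM coefMXn; case: ifP => _.
    by rewrite mulr0 subr0 nth_default // sp.
  rewrite !nth_default ?mulr0 ?subr0 // ?sp // sp0.
  by rewrite ltn_subRL subnK.
have := IH _ _ (leq_trans lt1 le_n) pq1.
by rewrite !hornerD !hornerN !hornerM px p0x q0y !(mul0r, mulr0) !subr0; apply.
Qed.

Definition pm_adjoin : set (K * K) :=
  [set u | exists p q, pm_poly p q /\ u = (p.[x], q.[y])].

Lemma pm_adjoin_morphism :
  [/\ partial_morphism pm_adjoin, S `<=` pm_adjoin & pm_adjoin (x, y)].
Proof.
have sub : S `<=` pm_adjoin.
  move=> u Su; exists u.1%:P, u.2%:P; split; first exact: pm_polyC.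
  by rewrite !hornerC; case: u {Su}.
split=> //; last first.
  by exists 'X, 'X; rewrite !hornerX; split=> //; exact: (pm_polyXn 1).
split=> [a b b0|_ _ [p [q [pq ->]]] [p' [q' [pq' ->]]]|_ _ [p [q [pq ->]]] [p' [q' [pq' ->]]]|z].
- by apply: sub; have [Sf _ _ _] := S_morph; exact: Sf.
- by exists (p - p'), (q - q'); rewrite !hornerE; split=> //; exact: pm_polyB.
- by exists (p * p'), (q * q'); rewrite !hornerE; split=> //; exact: pm_polyM.
- by move=> [p [q [pq [/esym px ->]]]]; exact: pm_root_transfer pq px.
Qed.

End Extension.

Lemma pm_min_poly S x : partial_morphism S ->
  exists p q, [/\ pm_poly S p q, p != 0, p.[x] = 0 &
    forall p' q', pm_poly S p' q' -> p' != 0 -> p'.[x] = 0 -> (size p <= size p')%N].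
Proof.
move=> S_morph.
pose P n := `[<exists p q, [/\ pm_poly S p q, p != 0, p.[x] = 0 & size p = n]>].
have [|_ /asboolP[p [q [pq p0 px <-]]] pmin] := @ex_minnP P.
  have [g g0 gx] := iota_alg x; exists (size (map_poly iota g)).
  apply/asboolP; exists (map_poly iota g), (map_poly iota g).
  split=> //; last by exact/eqP.
  - by move=> i; rewrite coef_map; exact: pm_iota.
  - apply: contra_neq g0 => g0; apply/polyP => i; apply: iota_inj.
    by rewrite -coef_map g0 !coef0 rmorph0.
exists p, q; split=> // p' q' pq' p'0 p'x; apply: pmin.
by apply/asboolP; exists p', q'.
Qed.

Lemma pm_extend S x : partial_morphism S ->
  exists S' y, [/\ partial_morphism S', S `<=` S' & S' (x, y)].
Proof.
move=> S_morph; have [p [q [pq p0 px pmin]]] := pm_min_poly x S_morph.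
have [y /eqP qy] : exists y, root q y.
  apply/closed_rootP; rewrite -(pm_size S_morph pq).
  apply/negP => /size_poly1P[c /eqP c0 pE]; apply: c0.
  by rewrite -px pE hornerC.
exists (pm_adjoin S x y), y; exact: (pm_adjoin_morphism S_morph pq).
Qed.

(** A maximal graph is total, because a missing element can be adjoined. *)
Lemma pm_total S1 : partial_morphism S1 ->
  exists S, [/\ partial_morphism S, S1 `<=` S & forall x, exists y, S (x, y)].
Proof.
move=> S1_morph.
(* The empty set satisfies [P], as the union of the empty chain. *)
pose P S := S !=set0 -> partial_morphism S /\ S1 `<=` S.
have [F FP Ftot|S [PS Smax]] := @Zorn_bigcup _ P.
  move=> [u0 [X0 FX0 X0u0]].
  have FPm X u : F X -> X u -> partial_morphism X /\ S1 `<=` X.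
    by move=> FX Xu; apply: FP => //; exists u.
  have join (X Y : set (K * K)) u v : F X -> F Y -> X u -> Y v ->
      exists Z, [/\ F Z, Z u & Z v].
    move=> FX FY Xu Yv; have [XY|YX] := Ftot _ _ FX FY.
      by exists Y; split=> //; exact: XY.
    by exists X; split=> //; exact: YX.
  have [X0_morph S1X0] := FPm _ _ FX0 X0u0.
  split; last by move=> u /S1X0 X0u; exists X0.
  split=> [a b b0|u v [X FX Xu] [Y FY Yv]|u v [X FX Xu] [Y FY Yv]|z [X FX Xz]].
  - by exists X0 => //; have [Sf _ _ _] := X0_morph; exact: Sf.
  - have [Z [FZ Zu Zv]] := join _ _ _ _ FX FY Xu Yv; exists Z => //.
    by have [Z_morph _] := FPm _ _ FZ Zu; exact: pmB Z_morph _ _ Zu Zv.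
  - have [Z [FZ Zu Zv]] := join _ _ _ _ FX FY Xu Yv; exists Z => //.
    by have [Z_morph _] := FPm _ _ FZ Zu; exact: pmM Z_morph _ _ Zu Zv.
  - by have [[_ _ _ S0] _] := FPm _ _ FX Xz; exact: S0.
have S_neq0 : S !=set0.
  apply: contrapT => /set0P/negP; rewrite negbK => /eqP S0.
  apply: (Smax S1); last by move=> _; split.
  rewrite S0; split=> // /(_ _ (pm0 S1_morph)); exact.
have [S_morph S1S] := PS S_neq0.
exists S; split=> // x; have [S' [y [S'_morph SS' S'xy]]] := pm_extend x S_morph.
exists y; apply: contrapT => nSxy; apply: (Smax S').
  by split=> // S'S; apply: nSxy; exact: S'S.
by move=> _; split=> //; exact: subset_trans SS'.
Qed.

(** The morphism permutes the finitely many roots of an equation of [z]. *)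
Lemma injective_algebraic_surj (s : {rmorphism K -> K}) :
  (forall c, s (iota c) = iota c) -> bijective s.
Proof.
move=> s_iota; have s_inj := fmorph_inj s.
suff surj z : exists t, s t = z.
  have /choice[g gK] := surj; exists g => // x; apply: s_inj; exact: gK.
have [q q0 qz] := iota_alg z.
have mq0 : map_poly iota q != 0.
  apply: contra_neq q0 => q0; apply/polyP => i; apply: iota_inj.
  by rewrite -coef_map q0 !coef0 rmorph0.
have [rs rsE] := closed_field_poly_normal (map_poly iota q).
have memrs t : (t \in undup rs) = root (map_poly iota q) t.
  by rewrite mem_undup rsE rootZ ?lead_coef_eq0 // root_prod_XsubC.
have : {subset map s (undup rs) <= undup rs}.
  move=> _ /mapP[t trs ->]; move: trs; rewrite !memrs => /eqP qt.
  apply/eqP; rewrite -[RHS](rmorph0 s) -qt -horner_map; congr (_.[_]).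
  by apply/polyP => i; rewrite !coef_map /= s_iota.
move=> /(uniq_min_size _)[||_ eqm]; rewrite ?map_inj_uniq ?undup_uniq ?size_map //.
have : z \in undup rs by rewrite memrs.
by rewrite -eqm => /mapP[t _ ->]; exists t.
Qed.

Lemma pm_automorphism S1 : partial_morphism S1 ->
  exists s : {rmorphism K -> K}, [/\ bijective s,
    forall c, s (iota c) = iota c & forall u, S1 u -> s u.1 = u.2].
Proof.
move=> /pm_total[S [S_morph S1S /choice[f Sf]]].
have uniqS x y : S (x, y) -> f x = y.
  move=> Sxy; apply/eqP; rewrite -subr_eq0 -(pm_eq0 S_morph (pmB S_morph (Sf x) Sxy)).
  by rewrite /= subrr.
have fB : nmod_morphism f.
  split=> [|x y]; apply: uniqS; first exact: pm0.
  exact: pmD S_morph _ _ (Sf x) (Sf y).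
have fM : monoid_morphism f.
  split=> [|x y]; apply: uniqS; first exact: pm1.
  exact: pmM S_morph _ _ (Sf x) (Sf y).
pose s : {rmorphism K -> K} := HB.pack f
  (GRing.isNmodMorphism.Build _ _ f fB) (GRing.isMonoidMorphism.Build _ _ f fM).
have s_iota c : s (iota c) = iota c by apply: uniqS; exact: pm_iota.
exists s; split=> //; first exact: injective_algebraic_surj.
by case=> x y /S1S; exact: uniqS.
Qed.

(** If the minimal polynomial of [x] is not linear, it has a root other than [x], because it
    has no double root in characteristic zero; an automorphism maps [x] to it. *)
Lemma fixed_by_automorphisms x :
    (forall n, (n.+1%:R : K) != 0) ->
    (forall s : {rmorphism K -> K}, bijective s ->
       (forall c, s (iota c) = iota c) -> s x = x) ->
  exists a b, b <> 0 /\ iota b * x = iota a.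
Proof.
move=> char0 x_fixed.
pose S (u : K * K) := exists a b, b <> 0 /\ u = (iota a / iota b, iota a / iota b).
have mul0 (a b : A) : a <> 0 -> b <> 0 -> a * b <> 0.
  move=> a0 b0 /(congr1 iota)/eqP.
  by rewrite rmorphM rmorph0 mulf_eq0 !(negbTE (iota_neq0 _)).
have S_morph : partial_morphism S.
  split=> [a b b0|_ _ [a [b [b0 ->]]] [c [d [d0 ->]]]|_ _ [a [b [b0 ->]]] [c [d [d0 ->]]]|y].
  - by exists a, b.
  - exists (a * d - c * b), (b * d); split; first exact: mul0.
    by rewrite /= -mulNr addf_div ?iota_neq0 // rmorphB !rmorphM mulNr.
  - exists (a * c), (b * d); split; first exact: mul0.
    by rewrite /= !rmorphM mulf_div.
  - by move=> [a [b [b0 [<- ->]]]].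
have diag u : S u -> u.1 = u.2 by move=> [a [b [_ ->]]].
have [p [q [pq p0 px pmin]]] := pm_min_poly x S_morph.
have pqE : p = q by apply/polyP => i; exact: (diag _ (pq i)).
rewrite -{q}pqE in pq.
have /factor_theorem[r pE] : root p x by apply/eqP.
have r0 : r != 0 by apply: contraNneq p0 => r0; rewrite pE r0 mul0r.
have sp : size p = (size r).+1.
  by rewrite pE size_Mmonic ?monicXsubC // size_XsubC addn2.
have sr : (0 < size r)%N by rewrite size_poly_gt0.
have [sr1|/closed_rootP[y /eqP ry]] := boolP (size r == 1%N).
  have [|v Sv [/= v1 _]] := pm_inv S_morph (pq 1%N).
    by rewrite -[1%N](_ : (size p).-1 = _) ?lead_coef_eq0 // sp (eqP sr1).
  have [a [b [b0 [xE _]]]] := pmM S_morph Sv (pmN S_morph (pq 0%N)).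
  exists a, b; split=> //.
  suff -> : x = v.1 * - p`_0 by rewrite xE mulrC divfK ?iota_neq0.
  move: px; rewrite horner_coef sp (eqP sr1) big_ord_recl big_ord1 /= expr0 expr1 mulr1.
  move=> /eqP; rewrite addrC addr_eq0 => /eqP <-.
  by rewrite mulrA v1 mul1r.
have [yx|yx] := eqVneq y x.
  have [d sd] : exists d, size p = d.+2 by exists (size r).-1; rewrite sp prednK.
  have pd i : p^`()`_i = p`_i.+1 *+ i.+1 by rewrite coef_deriv.
  have lead_neq0 : p^`()`_d != 0.
    rewrite pd -mulr_natr mulf_neq0 //.
    by have := p0; rewrite -lead_coef_eq0 lead_coefE sd.
  suff : (size p <= size p^`())%N by rewrite leqNgt lt_size_deriv.
  apply: (pmin _ p^`()).
  - by move=> i; rewrite pd; exact: (pmMn S_morph i.+1 (pq i.+1)).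
  - by apply: contraNneq lead_neq0 => ->; rewrite coef0.
  - by rewrite pE derivM derivXsubC mulr1 hornerD hornerM hornerXsubC subrr mulr0 add0r -yx.
have py : p.[y] = 0 by rewrite pE hornerM ry mul0r.
have [S'_morph SS' S'xy] := pm_adjoin_morphism S_morph pq p0 px pmin py.
have [s [s_bij s_iota sE]] := pm_automorphism S'_morph.
by have := x_fixed s s_bij s_iota; rewrite (sE _ S'xy) => /eqP; rewrite (negbTE yx).
Qed.

End Automorphisms.

(** * Counting with a free action of a cyclic p-group *)

Lemma iter_dvd_order (T : finType) (f : T -> T) n t :
  injective f -> iter n f t = t -> (fingraph.order f t %| n)%N.
Proof.
move=> f_inj nt; have /= E k : iter (k * fingraph.order f t) f t = t.
  by elim: k => // k IH; rewrite mulSn iterD IH iter_order.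
move: nt; rewrite {1}(divn_eq n (fingraph.order f t)) addnC iterD E => nt.
have lt_r : (n %% fingraph.order f t < fingraph.order f t)%N by rewrite ltn_mod fingraph.order_gt0.
have := findex_iter lt_r; rewrite nt findex0 => r0.
by rewrite /dvdn -r0.
Qed.

(** Away from [t0] every orbit has exactly [p ^ m] elements. *)
Lemma card_free_iter (T : finType) (f : T -> T) (t0 : T) p m :
    prime p -> (forall t, iter (p ^ m) f t = t) -> f t0 = t0 ->
    ((0 < m)%N -> forall t, iter (p ^ m.-1) f t = t -> t = t0) ->
  (p ^ m %| #|T|.-1)%N.
Proof.
move=> p_prime fm ft0 free.
have pm0 : (0 < p ^ m)%N by rewrite expn_gt0 prime_gt0.
have f_inj : injective f.
  move=> t t' ftt'; rewrite -(fm t) -(fm t') -(prednK pm0) !iterSr ftt' //.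
have orderE t : t != t0 -> fingraph.order f t = (p ^ m)%N.
  move=> tt0; have /(dvdn_pfactor _ _ p_prime)[j] := iter_dvd_order f_inj (fm t).
  rewrite leq_eqVlt => /orP[/eqP -> //|lt_jm] ordE.
  case/eqP: tt0; apply: free; first exact: leq_ltn_trans lt_jm.
  have /dvdnP[k ->] : (fingraph.order f t %| p ^ m.-1)%N.
    by rewrite ordE dvdn_exp2l // -ltnS prednK // (leq_ltn_trans _ lt_jm).
  by elim: k => // k IH; rewrite mulSn iterD IH iter_order.
have -> : #|T|.-1 = #|predC1 t0| by rewrite cardC1.
rewrite -(@fcard_order_set _ f f_inj (p ^ m)%N); first exact: dvdn_mull.
  by apply/fintype.subsetP => t; rewrite !inE => /orderE ->.
by move=> t t' /eqP <-; rewrite !inE -(inj_eq f_inj t) ft0.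
Qed.

(** [rep] enumerates [N / P] without repetition, and [g] generates an action of a cyclic group
    of order [p ^ m] on [N / P] whose subgroup of order [p] fixes only [0]. *)
Lemma card_quotient_free (V : zmodType) (N P : set V) (T : finType) (rep : T -> V)
    (g : V -> V) p m :
    prime p ->
    P 0 -> (forall x y, P x -> P y -> P (x - y)) ->
    N 0 -> (forall x y, N x -> N y -> N (x - y)) ->
    (forall t, N (rep t)) -> (forall y, N y -> exists t, P (y - rep t)) ->
    (forall t t', P (rep t - rep t') -> t = t') ->
    (forall x y, g (x - y) = g x - g y) ->
    (forall y, N y -> N (g y)) -> (forall y, P y -> P (g y)) ->
    (forall y, N y -> iter (p ^ m) g y = y) ->
    ((0 < m)%N -> forall y, N y -> P (iter (p ^ m.-1) g y - y) -> P y) ->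
  (p ^ m %| #|T|.-1)%N.
Proof.
move=> p_prime P0 PB N0 NB Nrep rep_onto rep_inj gB Ng Pg gm free.
have PN x : P x -> P (- x) by move=> Px; rewrite -(sub0r x); exact: PB.
have PD x y : P x -> P y -> P (x + y) by move=> Px /PN Py; rewrite -(opprK y); exact: PB.
have /choice[f fP] t : exists t', P (g (rep t) - rep t') by exact/rep_onto/Ng.
have [t0 t0P] := rep_onto 0 N0.
have iterP n t : P (iter n g (rep t) - rep (iter n f t)).
  elim: n => [|n IH]; first by rewrite subrr.
  by have := PD _ _ (Pg _ IH) (fP (iter n f t)); rewrite gB addrA subrK.
have g0 : g 0 = 0 by rewrite -(subrr 0) gB !subrr.
apply: (@card_free_iter T f t0) => //.
- move=> t; apply: rep_inj; rewrite -opprB; apply: PN.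
  by have := iterP (p ^ m)%N t; rewrite gm.
- apply: rep_inj; rewrite -(subrK (g (rep t0)) (rep (f t0))) -addrA.
  apply: PD; first by rewrite -opprB; exact/PN/fP.
  have Pt0 : P (rep t0) by move/PN: t0P; rewrite sub0r opprK.
  by apply: PB => //; exact: Pg.
- move=> m0 t ft; apply: rep_inj; apply: PB; last by move/PN: t0P; rewrite sub0r opprK.
  apply: free => //; have := iterP (p ^ m.-1)%N t; by rewrite ft.
Qed.

(** If [p ^ m] divides [l ^ b - 1], the order of [l] modulo [p ^ m] divides both [b] and
    [p ^ m.-1 * p.-1]. If moreover [p ^ k] does not divide [b], it divides
    [e = p ^ k * p.-1], so [p ^ m] divides the nonzero number [l ^ e - 1], which bounds [m]. *)
Lemma dvdn_expn_pred p l k : prime p -> (1 < l)%N -> coprime p l ->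
  exists m0, forall m b, (m0 <= m)%N -> (p ^ m %| (l ^ b).-1)%N -> (p ^ k %| b)%N.
Proof.
move=> p_prime l_gt1 co; set e := (p ^ k * p.-1)%N.
exists (l ^ e)%N => m b le_m.
have m_gt0 : (0 < m)%N by rewrite (leq_trans _ le_m) // expn_gt0 ltnW.
have modP n : (p ^ m %| (l ^ n).-1)%N = (l ^ n == 1 %[mod p ^ m]).
  by rewrite eqn_mod_dvd ?subn1 // expn_gt0 ltnW.
have [->|b_gt0] := posnP b; first by rewrite dvdn0.
rewrite modP => /eqP lb; apply: contraTT isT => ndvd.
set t := totient (p ^ m).
have lt : l ^ t = 1 %[mod p ^ m] by apply: Euler_exp_totient; rewrite coprime_sym coprimeXl.
have t_gt0 : (0 < t)%N by rewrite totient_gt0 expn_gt0 prime_gt0.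
have lg : l ^ gcdn b t = 1 %[mod p ^ m].
  have [u v uv _] := egcdnP t b_gt0.
  have powm a n : l ^ a = 1 %[mod p ^ m] -> l ^ (n * a) = 1 %[mod p ^ m].
    by move=> la; rewrite mulnC expnM -modnXm la modnXm exp1n.
  have := powm _ u lb; rewrite uv expnD -modnMml powm // modnMml mul1n.
  exact.
have g_gt0 : (0 < gcdn b t)%N by rewrite gcdn_gt0 b_gt0.
have : (gcdn b t %| e)%N.
  rewrite -(partnC p g_gt0) Gauss_dvd ?coprime_partC //.
  apply/andP; split.
    rewrite p_part dvdn_mulr // dvdn_exp2l //.
    rewrite (leq_trans (dvdn_leq_log p b_gt0 (dvdn_gcdl b t))) //.
    by rewrite leqNgt; apply: contra ndvd => /ltnW; rewrite -pfactor_dvdn.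
  have : ((gcdn b t)`_p^' %| t)%N := dvdn_trans (dvdn_part _ _) (dvdn_gcdr b t).
  have co' : coprime (gcdn b t)`_p^' (p ^ m.-1).
    rewrite coprime_sym; have := coprime_partC p (p ^ m.-1) (gcdn b t).
    by rewrite part_pnat_id // pnatX pnat_id.
  have tE : t = (p.-1 * p ^ m.-1)%N by rewrite /t totient_pfactor.
  by move=> gt; apply: dvdn_mull; rewrite -(Gauss_dvdl _ co') -tE.
move=> /dvdnP[q qE].
have : (p ^ m %| (l ^ e).-1)%N.
  by rewrite modP qE mulnC expnM; apply/eqP; rewrite -modnXm lg modnXm exp1n.
have e_gt0 : (0 < e)%N by rewrite muln_gt0 expn_gt0 prime_gt0 //= -subn1 subn_gt0 prime_gt1.
have le_gt1 : (1 < l ^ e)%N by rewrite -{1}(exp1n e) ltn_exp2r.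
have pred_gt0 : (0 < (l ^ e).-1)%N by rewrite -subn1 subn_gt0.
move/(dvdn_leq pred_gt0); rewrite leqNgt => /negP[].
by rewrite prednK ?(leq_trans le_m) ?(ltnW (ltn_expl _ (prime_gt1 p_prime))) // ltnW.
Qed.

(** * Characters of finite abelian groups *)

Section FiniteCharacters.
Variable K : closedFieldType.
Hypothesis char0 : forall n, (0 < n)%N -> (n%:R : K) != 0.

Lemma unity_roots n : (0 < n)%N -> exists rs : seq K,
  [/\ uniq rs, size rs = n, forall z, (z ^+ n == 1) = (z \in rs) &
      'X^n - 1 = \prod_(z <- rs) ('X - z%:P)].
Proof.
move=> n0; have [rs] := closed_field_poly_normal ('X^n - 1 : {poly K}).
have /monicP -> := monicXnsubC (1 : K) n0; rewrite scale1r => rsE.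
have sep : separable_poly ('X^n - 1 : {poly K}).
  rewrite separable_poly.unlock derivB derivXn -polyC1 derivC subr0.
  apply/Bezout_coprimepP; exists (-1, n%:R^-1 *: 'X) => /=.
  rewrite (_ : _ + _ = 1) ?eqpxx // -scalerAl mulrnAr -exprS prednK //.
  by rewrite -scaler_nat scalerA mulVf ?char0 // scale1r mulN1r opprB polyC1 subrK.
exists rs; split=> //.
- by rewrite -separable_prod_XsubC -rsE.
- have := congr1 (fun p : {poly K} => size p) rsE.
  by rewrite size_XnsubC // size_prod_XsubC => -[].
- move=> z; rewrite -root_prod_XsubC -rsE /root !hornerE.
  by rewrite subr_eq0.
Qed.

Lemma prim_root_exists n : (0 < n)%N -> exists z : K, n.-primitive_root z.
Proof.
move=> n0; have [rs [rs_uniq rs_size rsP _]] := unity_roots n0.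
have /hasP[z _ zP] : has n.-primitive_root rs.
  by apply: has_prim_root; rewrite ?rs_size //; apply/allP => z; rewrite unity_rootE rsP.
by exists z.
Qed.

Variable H : finGroupType.
Hypothesis H_abelian : abelian [set: H]%SET.
Implicit Types (chi psi : {ffun H -> K}) (g h : H).

Definition is_char chi := (chi 1%g == 1) && [forall g, forall h, chi (g * h)%g == chi g * chi h].

Lemma is_charP chi :
  reflect (chi 1%g = 1 /\ forall g h, chi (g * h)%g = chi g * chi h) (is_char chi).
Proof.
apply: (iffP andP) => [[/eqP chi1 /'forall_forallP chiM]|[chi1 chiM]].
  by split=> // g h; apply/eqP.
by split; [apply/eqP|apply/'forall_forallP => g h; apply/eqP].
Qed.

Lemma char_inv chi g : is_char chi -> chi g * chi g^-1%g = 1.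
Proof. by move=> /is_charP[chi1 chiM]; rewrite -chiM mulgV. Qed.

Lemma char_root1 chi g : is_char chi -> chi g ^+ #|[set: H]%SET| = 1.
Proof.
move=> /is_charP[chi1 chiM]; have E n : chi g ^+ n = chi (g ^+ n)%g.
  by elim: n => [|n IH]; rewrite ?expg0 ?chi1 // expgS chiM exprS IH.
by rewrite E expg_cardG ?chi1 ?inE.
Qed.

(** The quotient [psi / chi]. *)
Definition char_div chi psi : {ffun H -> K} := [ffun g => chi g^-1%g * psi g].

Lemma char_div_char chi psi : is_char chi -> is_char psi -> is_char (char_div chi psi).
Proof.
move=> /is_charP[chi1 chiM] /is_charP[psi1 psiM]; apply/is_charP; split=> [|g h].
  by rewrite ffunE invg1 chi1 psi1 mulr1.
rewrite !ffunE invMg chiM psiM [chi h^-1%g * _]mulrC.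
by rewrite mulrACA.
Qed.

Lemma char_div_eq1 chi psi : is_char chi -> is_char psi ->
  (forall g, char_div chi psi g = 1) -> chi = psi.
Proof.
move=> chi_char psi_char E; apply/ffunP => g; have := E g; rewrite ffunE => Eg.
by rewrite -[LHS]mulr1 -Eg mulrA char_inv // mul1r.
Qed.

Lemma simultaneous_diagonalization n (rho : H -> 'M[K]_n) :
    rho 1%g = 1%:M -> (forall g h, rho (g * h)%g = rho g *m rho h) ->
  exists2 P, P \in unitmx & forall g, is_diag_mx (P *m rho g *m invmx P).
Proof.
case: n rho => [|n] rho rho1 rhoM.
  by exists 1%:M; rewrite ?unitmx1 // => g; apply/is_diag_mxP => -[].
have rhoX g : rho g ^+ #|[set: H]%SET| = 1.
  have E k : rho g ^+ k = rho (g ^+ k)%g.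
    by elim: k => [|k IH]; rewrite ?expg0 ?rho1 // expgS rhoM exprS IH.
  by rewrite E expg_cardG ?rho1 ?inE.
have [rs [rs_uniq _ _ rsE]] := unity_roots (cardG_gt0 [set: H]%G).
have [|P Pu /allP/= Pdiag] := (mxpoly.codiagonalizableP [seq rho g | g <- enum H]).1.
  split=> [_ _ /mapP[g _ ->] /mapP[h _ ->]|_ /mapP[g _ ->]].
    have /centsP C := H_abelian.
    by rewrite /comm_mx -!rhoM (C g _ h) ?inE.
  apply/mxpoly.diagonalizableP; exists rs => //; rewrite -rsE; apply: mxminpoly_min.
  by rewrite rmorphB rmorphXn /= horner_mx_X rmorph1 rhoX subrr.
exists P => // g; rewrite -conjumx //.
by apply: Pdiag; apply: map_f; rewrite mem_enum.
Qed.

(** The matrices of the regular representation have finite order and commute,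
    so they are diagonal in a common basis; their diagonal entries are characters, which
    separate the group because the representation is faithful. *)
Lemma char_separates g : g != 1%g -> exists2 chi, is_char chi & chi g != 1.
Proof.
move=> g1; pose G := [set: H]%G; pose rho := regular_repr K G.
have inG x : x \in G by rewrite inE.
have rhoM x y : rho (x * y)%g = rho x *m rho y by exact: repr_mxM.
have rhog : rho g <> 1%:M.
  move=> rg; have gk : g \in rker rho by apply/rkerP; split=> //; exact: inG.
  have := fintype.subsetP (regular_mx_faithful K G) g gk.
  by rewrite inE (negbTE g1).
have codiag : exists2 P : 'M[K]_#|G|, P \in unitmx &
    forall x, is_diag_mx (P *m rho x *m invmx P).
  by apply: simultaneous_diagonalization => //; exact: repr_mx1.
have [P Pu Pdiag] := codiag.
pose D x := P *m rho x *m invmx P.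
have DM x y : D (x * y)%g = D x *m D y.
  by rewrite /D rhoM !mulmxA mulmxKV.
have D1 : D 1%g = 1%:M by rewrite /D repr_mx1 mulmx1 mulmxV.
have chiP i : is_char [ffun x => D x i i].
  apply/is_charP; split=> [|x y]; first by rewrite ffunE D1 mxE eqxx.
  rewrite !ffunE DM mxE (bigD1 i) //= big1 ?addr0 // => j ji.
  by rewrite [D x i j](is_diag_mxP (Pdiag x)) ?mul0r // eq_sym.
apply: contrapT => noc; apply: rhog.
have : D g = 1%:M.
  apply/matrixP => i j; rewrite [RHS]mxE; have [<-|ij] := eqVneq i j; last first.
    exact: (is_diag_mxP (Pdiag g)).
  apply/eqP; apply: contrapT => /negP Dg; apply: noc.
  by exists [ffun x => D x i i]; rewrite ?ffunE.
move=> /(congr1 (fun A => invmx P *m A *m P)).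
by rewrite /D mulmx1 mulVmx // !mulmxA mulVmx // mul1mx mulmxKV.
Qed.

Lemma char_seq : exists2 S : seq {ffun H -> K}, uniq S & forall chi, (chi \in S) = is_char chi.
Proof.
have H0 : (0 < #|[set: H]%SET|)%N by rewrite cardG_gt0.
have [rs [_ rs_size rsP _]] := unity_roots H0.
pose F (t : {ffun H -> 'I_#|[set: H]%SET|}) : {ffun H -> K} := [ffun g => rs`_(t g)].
exists (undup [seq F t | t <- enum {: {ffun H -> 'I_#|[set: H]%SET|}} & is_char (F t)]).
  exact: undup_uniq.
move=> chi; rewrite mem_undup; apply/mapP/idP => [[t + ->]|chiP].
  by rewrite mem_filter => /andP[].
have lt g : (index (chi g) rs < #|[set: H]%SET|)%N.
  by rewrite -[X in (_ < X)%N]rs_size index_mem -rsP char_root1.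
have E : F [ffun g => Ordinal (lt g)] = chi.
  by apply/ffunP => g; rewrite !ffunE /= nth_index // -rsP char_root1.
by exists [ffun g => Ordinal (lt g)]; rewrite // mem_filter E chiP mem_enum.
Qed.

Lemma sum_char chi : is_char chi ->
  \sum_g chi g = if [forall g, chi g == 1] then #|[set: H]%SET|%:R else 0.
Proof.
move=> /is_charP[chi1 chiM]; case: ifPn => [/forallP chi_triv|].
  under eq_bigr do rewrite (eqP (chi_triv _)).
  by rewrite sumr_const cardsT.
rewrite negb_forall => /existsP[h chih]; apply/eqP.
have /eqP : chi h * (\sum_g chi g) = \sum_g chi g.
  rewrite mulr_sumr [RHS](reindex_inj (mulgI h)) /=.
  by apply: eq_bigr => g _; rewrite chiM.
by rewrite -subr_eq0 -{2}[\sum_g _]mul1r -mulrBl mulf_eq0 subr_eq0 (negbTE chih).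
Qed.

Lemma char_orthogonality chi psi : is_char chi -> is_char psi ->
  \sum_g chi g^-1%g * psi g = if chi == psi then #|[set: H]%SET|%:R else 0.
Proof.
move=> chiP psiP.
have -> : \sum_g chi g^-1%g * psi g = \sum_g char_div chi psi g.
  by apply: eq_bigr => g _; rewrite ffunE.
rewrite sum_char ?char_div_char //; congr (if _ then _ else _).
apply/forallP/eqP => [E|-> g].
  by apply: char_div_eq1 => // g; exact/eqP.
by rewrite ffunE mulrC char_inv.
Qed.

(** Multiplication by a character [psi] permutes the characters, so the sum [s] of their
    values at [h] satisfies [psi h * s = s], and some [psi] has [psi h != 1] unless [h = 1]. That
    there are as many characters as elements follows by summing over the whole group. *)
Lemma char_column_orthogonality (S : seq {ffun H -> K}) g :
    uniq S -> (forall chi, (chi \in S) = is_char chi) ->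
  \sum_(chi <- S) chi g = if g == 1%g then #|[set: H]%SET|%:R else 0.
Proof.
move=> S_uniq SP.
have off h : h != 1%g -> \sum_(chi <- S) chi h = 0.
  move=> h1; have [psi psiP psih] := char_separates h1.
  have : perm_eq (map (char_div psi) S) S.
    have inj : {in S &, injective (char_div psi)}.
      move=> chi chi' _ _ E; apply/ffunP => x.
      have := congr1 (fun f : {ffun H -> K} => f x) E; rewrite !ffunE; apply: mulfI.
      apply/eqP => x0; have := char_inv x psiP; rewrite x0 mulr0 => /eqP.
      by rewrite eq_sym oner_eq0.
    apply: uniq_perm => //; first by rewrite map_inj_in_uniq.
    apply: (uniq_min_size _ _ _).2; rewrite ?map_inj_in_uniq ?size_map //.
    by move=> _ /mapP[chi chiS ->]; rewrite SP char_div_char // -SP.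
  move=> /(perm_big _) E.
  have /eqP : psi h^-1%g * (\sum_(chi <- S) chi h) = \sum_(chi <- S) chi h.
    rewrite -[RHS]E big_map mulr_sumr; apply: eq_bigr => chi _.
    by rewrite ffunE.
  rewrite -subr_eq0 -{2}[\sum_(chi <- S) _]mul1r -mulrBl mulf_eq0 subr_eq0.
  case/orP => [/eqP psiV|/eqP //].
  by have := char_inv h psiP; rewrite psiV mulr1 => /eqP; rewrite (negbTE psih).
have [->|/off //] := eqVneq g 1%g.
have <- : \sum_(chi <- S) \sum_h chi h = #|[set: H]%SET|%:R.
  have triv : is_char [ffun=> 1] by apply/is_charP; split=> *; rewrite !ffunE ?mulr1.
  rewrite (bigD1_seq [ffun=> 1]) ?SP //= sum_char // big_seq_cond big1 => [|chi].
    by case: forallP => [_|[]]; rewrite ?addr0 // => h; rewrite ffunE.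
  rewrite SP => /andP[chiP chi1]; rewrite sum_char //; case: forallP => // E.
  by case/eqP: chi1; apply/ffunP => h; rewrite ffunE (eqP (E h)).
by rewrite [RHS]exchange_big [RHS](bigD1 1%g) //= [X in _ = _ + X]big1 ?addr0 // => h /off.
Qed.

End FiniteCharacters.

(** * Fourier analysis on the Iwasawa algebra *)

Section GroupRingFourier.
Variables (A : comNzRingType) (K : closedFieldType) (iota : {rmorphism A -> K}).
Implicit Type H : finGroupType.

(** The linear extension of [chi] to the group ring. *)
Definition evc H (chi : {ffun H -> K}) (x : gring A H) : K := \sum_g iota (x g) * chi g.

Lemma evcB H (chi : {ffun H -> K}) x y : evc chi (x - y) = evc chi x - evc chi y.
Proof.
by rewrite /evc -sumrB; apply: eq_bigr => g _; rewrite !ffunE rmorphB mulrBl.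
Qed.

Lemma evc_mono H (chi : {ffun H -> K}) c g : evc chi (gr_mono c g) = iota c * chi g.
Proof.
rewrite /evc (bigD1 g) //= ffunE eqxx big1 ?addr0 // => h /negbTE hg.
by rewrite ffunE hg rmorph0 mul0r.
Qed.

Lemma evcM H (chi : {ffun H -> K}) x y :
  is_char chi -> evc chi (x * y) = evc chi x * evc chi y.
Proof.
move=> /is_charP[chi1 chiM]; rewrite /evc mulr_suml.
under eq_bigr => g _ do rewrite ffunE rmorph_sum mulr_suml.
rewrite exchange_big /=; apply: eq_bigr => h _.
rewrite mulr_sumr (reindex_inj (mulgI h)) /=; apply: eq_bigr => g _.
by rewrite mulKg rmorphM chiM mulrACA.
Qed.

Lemma evc_map (H H' : finGroupType) (f : {morphism [set: H]%SET >-> H'}) (chi : {ffun H' -> K}) x :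
  evc chi (gr_map f x) = evc [ffun g => chi (f g)] x.
Proof.
rewrite /evc [RHS](partition_big f predT) //=; apply: eq_bigr => h _.
rewrite ffunE rmorph_sum mulr_suml; apply: eq_bigr => g /eqP fg.
by rewrite ffunE fg.
Qed.

Hypothesis char0 : forall n, (0 < n)%N -> (n%:R : K) != 0.

Lemma fourier_inversion H (S : seq {ffun H -> K}) (x : gring A H) h :
    abelian [set: H]%SET -> uniq S -> (forall chi, (chi \in S) = is_char chi) ->
  iota (x h) = #|H|%:R^-1 * \sum_(chi <- S) chi h^-1%g * evc chi x.
Proof.
move=> H_abelian S_uniq SP.
have H0 : (#|H|%:R : K) != 0 by rewrite char0 // -cardsT cardG_gt0.
apply: (mulfI H0); rewrite mulVKf //.
have inner g : \sum_(chi <- S) chi h^-1%g * (iota (x g) * chi g)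
    = if g == h then #|H|%:R * iota (x h) else 0.
  transitivity (iota (x g) * \sum_(chi <- S) chi (h^-1 * g)%g).
    rewrite mulr_sumr big_seq [RHS]big_seq; apply: eq_bigr => chi.
    by rewrite SP => /is_charP[_ chiM]; rewrite chiM mulrCA.
  rewrite (char_column_orthogonality char0 H_abelian) // -eq_invg_mul invgK eq_sym cardsT.
  by have [->|_] := eqVneq g h; rewrite ?mulr0 // mulrC.
under eq_bigr do rewrite mulr_sumr.
rewrite exchange_big; under eq_bigr do rewrite inner.
by rewrite -big_mkcond big_pred1_eq.
Qed.

End GroupRingFourier.

Section ProGroup.
Variables (p : nat) (G : pro_p_system p).
Local Notation Gamma := (proGroup G).

Lemma transition_onto n (g : G n) : exists h, transition G n h = g.
Proof.
have : g \in (transition G n @* [set: G n.+1]%SET)%g by rewrite transition_surj finset.in_setT.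
by move=> /morphimP[h _ _ ->]; exists h.
Qed.

Lemma level_down n (g : G n) : exists d : forall k, G k,
  d n = g /\ forall k, (k < n)%N -> transition G k (d k.+1) = d k.
Proof.
elim: n g => [|n IH] g.
  by exists (fun k => if k is 0 then g else 1%g).
have [d [dn dP]] := IH (transition G n g).
exists (dfwith d g); split; first by rewrite dfwith_in.
move=> k; rewrite ltnS leq_eqVlt => /orP[/eqP ->|lt_kn].
  by rewrite dfwith_in dfwith_out ?dn // neq_ltn ltnSn orbT.
by rewrite !dfwith_out ?dP // neq_ltn ?ltnS ?lt_kn ?(ltnW lt_kn) orbT.
Qed.

(** A compatible family is obtained from [g] by the transition maps below level [n], and by
    sections of them above. *)
Lemma proGroup_onto n (g : G n) : exists x : Gamma, x n = g.
Proof.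
have [d [dn dP]] := level_down g.
pose s k (h : G k) := projT1 (cid (transition_onto h)).
have sP k (h : G k) : transition G k (s k h) = h by rewrite /s; case: cid.
pose u := nat_rect (fun k => G k) (d 0%N)
  (fun k uk => if (k < n)%N then d k.+1 else s k uk).
have u_low k : (k <= n)%N -> u k = d k.
  by case: k => //= k ->.
have uP k : transition G k (u k.+1) = u k.
  rewrite /=; case: ltnP => [lt_kn|_]; first by rewrite dP // u_low // ltnW.
  exact: sP.
by exists (ProGroup uP); rewrite /= u_low.
Qed.

End ProGroup.

(** * Restriction of scalars to the l-adic integers *)

Section RestrictScalars.
Variables (l p : nat) (G : pro_p_system p).
Local Notation Zl := (padic_int l).
Local Notation LG := (Lambda l G).

Lemma scalD (c d : Zl) : scal G (c + d) = scal G c + scal G d.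
Proof.
by apply: invlim_ext => n; apply/ffunP => g; rewrite !ffunE; case: ifP; rewrite ?addr0.
Qed.

Lemma scalM (c d : Zl) : scal G (c * d) = scal G c * scal G d.
Proof.
apply: invlim_ext => n; apply/ffunP => g; rewrite !ffunE.
rewrite (bigD1 1%g) //= !ffunE eqxx invg1 mul1g big1 ?addr0 => [|h /negbTE h1].
  by case: ifP; rewrite ?mulr0.
by rewrite ffunE h1 mul0r.
Qed.

Lemma scal1 : scal G (1 : Zl) = 1 :> LG.
Proof. by apply: invlim_ext. Qed.

(** A copy of [M], to carry the second module structure. *)
Definition restricted (M : lmodType LG) : Type := M.

Variable M : lmodType LG.
HB.instance Definition _ := GRing.Zmodule.on (restricted M).

Definition restricted_scale (c : Zl) (x : restricted M) : restricted M :=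
  scal G c *: (x : M).

Fact restricted_scaleA a b x :
  restricted_scale a (restricted_scale b x) = restricted_scale (a * b) x.
Proof. by rewrite /restricted_scale scalM scalerA. Qed.
Fact restricted_scale1 : left_id 1 restricted_scale.
Proof. by move=> x; rewrite /restricted_scale scal1 scale1r. Qed.
Fact restricted_scaleDr : right_distributive restricted_scale +%R.
Proof. by move=> c x y; exact: scalerDr. Qed.
Fact restricted_scaleDl x : {morph restricted_scale^~ x : a b / a + b}.
Proof. by move=> a b; rewrite /restricted_scale scalD scalerDl. Qed.
HB.instance Definition _ := GRing.Zmodule_isLmodule.Build Zl (restricted M)
  restricted_scaleA restricted_scale1 restricted_scaleDr restricted_scaleDl.

End RestrictScalars.

(** * Characters of the profinite group *)

Section Dual.
Variables (p l : nat) (p_prime : prime p) (l_prime : prime l) (l_neq_p : l <> p).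
Variables (G : pro_p_system p) (K : closedFieldType) (iota : {rmorphism padic_int l -> K}).
Hypothesis K_closure : is_algclosure iota.
Local Notation Gamma := (proGroup G).
Local Notation Zl := (padic_int l).
Local Notation LG := (Lambda l G).
Implicit Types (w v : Gamma -> K) (O : set (Gamma -> K)) (a b : LG).

Lemma iota_inj : injective iota. Proof. by case: K_closure. Qed.

Lemma K_char0 n : (0 < n)%N -> (n%:R : K) != 0.
Proof. exact: (iota_natr_neq0 l_prime iota_inj). Qed.

Definition lift_level n (g : G n) : Gamma := projT1 (cid (proGroup_onto g)).

Lemma lift_levelK n (g : G n) : lift_level g n = g.
Proof. by rewrite /lift_level; case: cid. Qed.

Definition factors n w : Prop := forall x y : Gamma, x n = y n -> w x = w y.

Lemma pro_comp_le n k (x y : Gamma) : (n <= k)%N -> x k = y k -> x n = y n.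
Proof.
move=> /subnK <-; elim: (k - n)%N => // d IH; rewrite addSn => E; apply: IH.
by rewrite -(pro_compP x) E pro_compP.
Qed.

Lemma factors_le n k w : (n <= k)%N -> factors n w -> factors k w.
Proof. by move=> le_nk wn x y xy; apply: wn; exact: pro_comp_le xy. Qed.

Lemma dual1 w : dual_group w -> w 1%g = 1.
Proof.
case=> wM w_fin _; have [n n0 wn] := w_fin 1%g.
have w0 : w 1%g != 0.
  by apply: contra_eqN wn => /eqP ->; rewrite expr0n gtn_eqF // eq_sym oner_eq0.
by apply: (mulfI w0); rewrite -wM mul1g mulr1.
Qed.

(** Continuity at the identity suffices, because [w] is a morphism. *)
Lemma dual_factors w : dual_group w -> exists n, factors n w.
Proof.
move=> wd; have [wM _ w_loc] := wd; have [n wn] := w_loc 1%g.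
exists n => x y xy; have w1 : w (x * y^-1)%g = w 1%g by apply: wn; rewrite /= xy mulgV.
by rewrite -[x](mulgKV y) wM w1 dual1 // mul1r.
Qed.

Definition pull n (chi : {ffun G n -> K}) : Gamma -> K := fun x => chi (x n).
Definition push n w : {ffun G n -> K} := [ffun g => w (lift_level g)].

Lemma pushK n w : factors n w -> pull (push n w) = w.
Proof. by move=> wn; apply/funext => x; rewrite /pull ffunE; apply: wn; rewrite lift_levelK. Qed.

Lemma pullK n : cancel (@pull n) (push n).
Proof. by move=> chi; apply/ffunP => g; rewrite ffunE /pull lift_levelK. Qed.

Lemma pull_factors n (chi : {ffun G n -> K}) : factors n (pull chi).
Proof. by move=> x y; rewrite /pull => ->. Qed.

Lemma pull_dual n (chi : {ffun G n -> K}) : is_char chi -> dual_group (pull chi).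
Proof.
move=> chiP; split=> [x y|x|x].
- by have /is_charP[_ chiM] := chiP; exact: chiM.
- by exists #|[set: G n]%SET|; rewrite ?cardG_gt0 //; exact: char_root1.
- by exists n => y; rewrite /pull => ->.
Qed.

Lemma push_char n w : dual_group w -> factors n w -> is_char (push n w).
Proof.
move=> wd wn; have [wM _ _] := wd.
apply/is_charP; split=> [|g h]; rewrite !ffunE.
  by rewrite -(dual1 wd); apply: wn; rewrite lift_levelK.
by rewrite -wM; apply: wn; rewrite /= !lift_levelK.
Qed.

Definition chars n : seq {ffun G n -> K} := projT1 (cid2 (@char_seq K K_char0 (G n))).

Lemma chars_uniq n : uniq (chars n).
Proof. by rewrite /chars; case: cid2. Qed.

Lemma charsP n chi : (chi \in chars n) = is_char chi.
Proof. by rewrite /chars; case: cid2 => /= S _ ->. Qed.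

Definition dual_seq n : seq (Gamma -> K) := [seq pull chi | chi <- chars n].

Lemma dual_seq_uniq n : uniq (dual_seq n).
Proof. by rewrite map_inj_uniq ?chars_uniq //; exact: can_inj (@pullK n). Qed.

Lemma dual_seqP n w : w \in dual_seq n <-> dual_group w /\ factors n w.
Proof.
split=> [/mapP[chi]|[wd wn]].
  by rewrite charsP => chiP ->; split; [exact: pull_dual|exact: pull_factors].
by rewrite -(pushK wn) map_f // charsP push_char.
Qed.

(** * Evaluation at a character *)

Definition ev_level n w a : K := evc iota (push n w) (a n).

Lemma ev_level_le n k w a : factors n w -> (n <= k)%N -> ev_level k w a = ev_level n w a.
Proof.
move=> wn /subnK <-; elim: (k - n)%N => // d <-; rewrite addSn /ev_level.
rewrite -(lim_compP a (d + n)%N) evc_map; congr evc; apply/ffunP => g; rewrite !ffunE.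
apply: (factors_le (leq_addl d n) wn); rewrite lift_levelK -(pro_compP (lift_level g)).
by rewrite lift_levelK.
Qed.

Definition level_of w : nat := xget 0%N [set n | factors n w].

(** The extension of [w] to a ring morphism on [Lambda]; any level through which [w] factors
    gives the same value, by [evE]. *)
Definition ev w a : K := ev_level (level_of w) w a.

Lemma evE n w a : factors n w -> ev w a = ev_level n w a.
Proof.
move=> wn; have wl : factors (level_of w) w by exact: (@xgetI _ 0%N [set n | factors n w] n wn).
by rewrite /ev -(ev_level_le a wl (leq_maxl _ n)) -(ev_level_le a wn (leq_maxr (level_of w) _)).
Qed.

Lemma ev_rmorphism w : dual_group w -> exists f : {rmorphism LG -> K}, f =1 ev w.
Proof.
move=> wd; have [n wn] := dual_factors wd.
have evB : zmod_morphism (ev w).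
  by move=> a b; rewrite !(evE _ wn) -evcB.
have evM : monoid_morphism (ev w).
  split=> [|a b]; rewrite !(evE _ wn); last by rewrite -evcM ?push_char.
  have /is_charP[w1 _] := push_char wd wn.
  have -> : ev_level n w 1 = evc iota (push n w) (gr_mono 1 1%g) by [].
  by rewrite evc_mono rmorph1 mul1r.
pose f : {rmorphism LG -> K} := HB.pack (ev w)
  (GRing.isZmodMorphism.Build _ _ (ev w) evB) (GRing.isMonoidMorphism.Build _ _ (ev w) evM).
by exists f.
Qed.

Section Evaluation.
Variable w : Gamma -> K.
Hypothesis wd : dual_group w.

Lemma ev0 : ev w 0 = 0. Proof. by have [f <-] := ev_rmorphism wd; rewrite rmorph0. Qed.
Lemma ev1 : ev w 1 = 1. Proof. by have [f <-] := ev_rmorphism wd; rewrite rmorph1. Qed.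
Lemma evB a b : ev w (a - b) = ev w a - ev w b.
Proof. by have [f fE] := ev_rmorphism wd; rewrite -!fE rmorphB. Qed.
Lemma evM a b : ev w (a * b) = ev w a * ev w b.
Proof. by have [f fE] := ev_rmorphism wd; rewrite -!fE rmorphM. Qed.
Lemma ev_sum (I : Type) (r : seq I) (P : pred I) (F : I -> LG) :
  ev w (\sum_(i <- r | P i) F i) = \sum_(i <- r | P i) ev w (F i).
Proof.
have [f fE] := ev_rmorphism wd; rewrite -fE rmorph_sum.
by apply: eq_bigr => i _; rewrite fE.
Qed.
Lemma ev_mono c g : ev w (Lmono c g) = iota c * w g.
Proof.
have [n wn] := dual_factors wd; rewrite (evE _ wn).
have -> : ev_level n w (Lmono c g) = evc iota (push n w) (gr_mono c (g n)) by [].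
by rewrite evc_mono ffunE; congr (_ * _); apply: wn; rewrite lift_levelK.
Qed.
Lemma ev_scal c : ev w (scal G c) = iota c.
Proof. by rewrite ev_mono dual1 // mulr1. Qed.

End Evaluation.

Lemma evc_separates n (x y : gring Zl (G n)) :
    (forall w, dual_group w -> factors n w ->
       evc iota (push n w) x = evc iota (push n w) y) ->
  x = y.
Proof.
move=> xy; apply/eqP; rewrite -subr_eq0; apply/eqP/ffunP => g; apply: iota_inj.
rewrite (fourier_inversion iota K_char0 _ g (level_abelian G n) (chars_uniq n) (@charsP n)).
rewrite big_seq big1 ?mulr0 => [|chi]; first by rewrite ffunE rmorph0.
rewrite charsP => chiP; rewrite evcB -(pullK chi).
by rewrite xy ?subrr ?mulr0 //; [exact: pull_dual|exact: pull_factors].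
Qed.

Lemma ev_separates_level n a b :
  (forall w, dual_group w -> factors n w -> ev w a = ev w b) -> a n = b n.
Proof.
by move=> ab; apply: evc_separates => w wd wn; have := ab w wd wn; rewrite !(evE _ wn).
Qed.

Lemma ev_separates a b : (forall w, dual_group w -> ev w a = ev w b) -> a = b.
Proof.
move=> ab; apply: invlim_ext => n; apply: ev_separates_level => w wd _; exact: ab.
Qed.

(** * Galois orbits of characters *)

Local Notation gal := (@galois_group l K iota).

Lemma galois_id : gal idfun.
Proof. by split=> //; exists idfun. Qed.

Lemma galois_comp s t : gal s -> gal t -> gal (s \o t).
Proof.
by case=> s_bij s_iota [t_bij t_iota]; split; [exact: bij_comp|move=> c /=; rewrite t_iota s_iota].
Qed.

Lemma galois_inv s : gal s -> exists t, gal t /\ cancel s t.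
Proof.
case=> -[t sK tK] s_iota; have s_inj := can_inj sK.
have tB : zmod_morphism t by move=> x y; apply: s_inj; rewrite rmorphB !tK.
have tM : monoid_morphism t.
  by split=> [|x y]; apply: s_inj; rewrite ?rmorph1 ?rmorphM !tK.
pose t' : {rmorphism K -> K} := HB.pack t
  (GRing.isZmodMorphism.Build _ _ t tB) (GRing.isMonoidMorphism.Build _ _ t tM).
exists t'; split=> //; split=> [|c]; first by exists s.
by apply: s_inj; rewrite tK s_iota.
Qed.

Local Notation orb w := (orbit_of iota w).

Lemma orbit_refl w : orb w w.
Proof. by exists idfun => //; exact: galois_id. Qed.

Lemma orbit_eq w v : orb w v -> orb v = orb w.
Proof.
case=> s sg <-; apply/seteqP; split=> _ [t tg <-].
  by exists (t \o s) => //; exact: galois_comp.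
have [s' [s'g sK]] := galois_inv sg; exists (t \o s'); first exact: galois_comp.
by apply/funext => g /=; rewrite sK.
Qed.

Lemma galois_dual (s : {rmorphism K -> K}) w : dual_group w -> dual_group (fun g => s (w g) : K).
Proof.
case=> wM w_fin w_loc; split=> [x y|x|x].
- by rewrite wM rmorphM.
- by have [n n0 wn] := w_fin x; exists n; rewrite // -rmorphXn wn rmorph1.
- by have [n wn] := w_loc x; exists n => y /wn ->.
Qed.

Lemma orbit_dual w v : dual_group w -> orb w v -> dual_group v.
Proof. by move=> wd [s _ <-]; exact: galois_dual. Qed.

Lemma orbit_factors n w v : factors n w -> orb w v -> factors n v.
Proof. by move=> wn [s _ <-] x y /wn ->. Qed.

Lemma ev_galois (s : {rmorphism K -> K}) w a :
  gal s -> dual_group w -> ev (fun g => s (w g)) a = s (ev w a).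
Proof.
case=> _ s_iota wd; have [n wn] := dual_factors wd.
have swn : factors n (fun g => s (w g)) by move=> x y /wn ->.
rewrite (evE _ wn) (evE _ swn) /ev_level /evc rmorph_sum; apply: eq_bigr => g _.
by rewrite !ffunE rmorphM s_iota.
Qed.

(** * The idempotents *)

Lemma card_level_unit n : exists u : Zl, iota u = (#|G n|%:R)^-1.
Proof.
have [k cardG] : exists k, #|G n| = (p ^ k)%N.
  have /p_natP[k kE] := level_pgroup G n; exists k.
  by rewrite -kE cardsT.
have [|u uE] := @padic_nat_unit l l_prime #|G n|.
  rewrite cardG coprimeXr // prime_coprime // dvdn_prime2 //; exact/eqP.
exists u; have n0 : (#|G n|%:R : K) != 0.
  by rewrite K_char0 // cardG expn_gt0 prime_gt0.
by apply: (mulfI n0); rewrite mulfV // -(rmorph_nat iota) -rmorphM uE rmorph1.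
Qed.

(** An automorphism permutes the characters in an orbit, so it fixes this Fourier
    coefficient, which is also integral, as a sum of roots of unity divided by a unit. *)
Lemma orbit_sum_rational n w (y : Gamma) : dual_group w ->
  exists c, iota c = #|G n|%:R^-1 * \sum_(v <- dual_seq n | `[< orb w v >]) v y.
Proof.
move=> wd; have [u uE] := card_level_unit n.
suff [c cE] : exists c, iota c = \sum_(v <- dual_seq n | `[< orb w v >]) v y.
  by exists (u * c); rewrite rmorphM uE cE.
have integral : integralOver iota (\sum_(v <- dual_seq n | `[< orb w v >]) v y).
  rewrite big_seq_cond; apply: (big_ind (integralOver iota)).
  - exact: integral0.
  - by move=> ? ?; exact: integral_add.
  move=> v /andP[/dual_seqP[[_ v_fin _] _] _]; have [k k0 vk] := v_fin y.
  exists ('X^k - 1); first exact: monicXnsubC.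
  by rewrite rmorphB /= map_polyXn rmorph1 /root !hornerE vk subrr.
have [|s s_bij s_iota|a [b [b0 ab]]] := fixed_by_automorphisms iota_inj (proj2 K_closure)
    (x := \sum_(v <- dual_seq n | `[< orb w v >]) v y).
- by move=> k; exact: K_char0.
- have sg : gal s by [].
  rewrite -big_filter rmorph_sum; set T := filter _ _.
  have TP v : v \in T <-> orb w v /\ v \in dual_seq n.
    rewrite mem_filter; split=> [/andP[/asboolP]|[? ?]] //.
    by apply/andP; split=> //; apply/asboolP.
  have inj : injective (fun v : Gamma -> K => (fun g => s (v g))).
    move=> v v' E; apply/funext => g; apply: (fmorph_inj s).
    exact: (congr1 (fun f => f g) E).
  have T_uniq : uniq T by rewrite filter_uniq // dual_seq_uniq.
  have /(perm_big _) permT : perm_eq [seq (fun g => s (v g)) | v <- T] T.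
    apply: uniq_perm => //; first by rewrite map_inj_uniq.
    apply: (uniq_min_size _ _ _).2; rewrite ?map_inj_uniq ?size_map //.
    move=> _ /mapP[v /TP[wv /dual_seqP[vd vn]] ->]; apply/TP; split.
      have [t tg <-] := wv; exists (s \o t) => //; exact: galois_comp.
    by apply/dual_seqP; split; [exact: galois_dual|move=> x z /vn ->].
  by rewrite -[RHS]permT big_map.
exact: (padic_integrally_closed l_prime iota_inj b0 ab).
Qed.

(** The Fourier coefficients of [idem], known at each level by inversion, are
    compatible because Fourier inversion also makes them unique. *)
Lemma orbit_idempotent w : dual_group w -> exists e : LG,
  (forall v, dual_group v -> ev v e = (`[< orb w v >])%:R) /\ idempotent_spec iota (orb w) e.
Proof.
move=> wd.
pose coef n (g : G n) : Zl := projT1 (cid (orbit_sum_rational n (lift_level g)^-1%g wd)).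
have coefE n (g : G n) : iota (coef n g) =
    #|G n|%:R^-1 * \sum_(v <- dual_seq n | `[< orb w v >]) v (lift_level g)^-1%g.
  by rewrite /coef; case: cid.
pose e n : gring Zl (G n) := if `[< factors n w >] then [ffun g => coef n g] else 0.
have e_ev n v : dual_group v -> factors n v -> evc iota (push n v) (e n) = (`[< orb w v >])%:R.
  move=> vd vn; rewrite /e; case: asboolP => [wn|nwn]; last first.
    rewrite asboolF => [|wv]; last first.
      by apply: nwn; apply: (orbit_factors vn); rewrite (orbit_eq wv); exact: orbit_refl.
    by rewrite /evc big1 // => g _; rewrite ffunE rmorph0 mul0r.
  have n0 : (#|G n|%:R : K) != 0 by rewrite K_char0 // -cardsT cardG_gt0.
  apply: (mulfI n0); rewrite /evc mulr_sumr.
  under eq_bigr do rewrite ffunE coefE mulrA mulVKf // mulr_suml.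
  rewrite exchange_big /=.
  have inner v' : v' \in dual_seq n ->
      \sum_g v' (lift_level g)^-1%g * push n v g = if v' == v then #|G n|%:R else 0.
    move=> /dual_seqP[v'd v'n].
    transitivity (\sum_g push n v' g^-1%g * push n v g).
      apply: eq_bigr => g _; rewrite [push n v' _]ffunE; congr (_ * _); apply: v'n.
      by rewrite /= !lift_levelK.
    rewrite char_orthogonality ?push_char // cardsT.
    congr (if _ then _ else _); apply/eqP/eqP => [E|-> //].
    by rewrite -(pushK v'n) E pushK.
  rewrite big_mkcond (bigD1_seq v) ?dual_seq_uniq //=; last exact/dual_seqP.
  rewrite inner; last exact/dual_seqP.
  rewrite eqxx big_seq_cond big1 => [|v' /andP[v'S v'v]].
    by rewrite addr0; case: asboolP; rewrite ?mulr1 ?mulr0.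
  by case: ifP => // _; rewrite inner // (negbTE v'v).
have eP n : gr_map (transition G n) (e n.+1) = e n.
  apply: evc_separates => v vd vn; rewrite evc_map.
  have vSn := factors_le (leqnSn n) vn.
  rewrite (e_ev n v vd vn) -(e_ev n.+1 v vd vSn); congr evc; apply/ffunP => g; rewrite !ffunE.
  by apply: vn; rewrite lift_levelK -(pro_compP (lift_level g)) lift_levelK.
exists (InvLim eP); split=> [v vd|n].
  by have [n vn] := dual_factors vd; rewrite (evE _ vn) -(e_ev n).
split=> [wn x|nwn]; last first.
  rewrite /= /e asboolF // => wn; apply: nwn => v wv; exact: orbit_factors wv.
rewrite /= /e asboolT; last exact/wn/orbit_refl.
rewrite ffunE coefE -[X in _ * X = _]big_filter mulr_sumr.
have TE : [set` [seq v <- dual_seq n | `[< orb w v >]]] = orb w.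
  apply/seteqP; split=> v /=; rewrite mem_filter; first by case/andP => /asboolP.
  move=> wv; apply/andP; split; first exact/asboolP.
  by apply/dual_seqP; split; [exact: orbit_dual wv|exact: wn].
rewrite -[in RHS]TE -fsbig_seq ?filter_uniq ?dual_seq_uniq //.
rewrite big_seq [RHS]big_seq; apply: eq_bigr => v.
rewrite mem_filter => /andP[_ /dual_seqP[_ vn]]; congr (_ * _); apply: vn.
by rewrite /= lift_levelK.
Qed.

Lemma idem_ev w v : dual_group w -> dual_group v ->
  ev v (idem iota (orb w)) = (`[< orb w v >])%:R.
Proof.
move=> wd vd; have [e [eE e_spec]] := orbit_idempotent wd.
have uniq_spec e' : idempotent_spec iota (orb w) e' -> e' = e.
  move=> e'_spec; apply: invlim_ext => n; have [f nf] := e_spec n; have [f' nf'] := e'_spec n.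
  have [wn|nwn] := pselect (factors_through n (orb w)); last by rewrite nf ?nf'.
  by apply/ffunP => g; apply: iota_inj; rewrite -(lift_levelK g) f ?f'.
have idemP : idempotent_spec iota (orb w) (idem iota (orb w)).
  exact: (@xgetI _ 0 [set e | idempotent_spec iota (orb w) e] e).
by rewrite (uniq_spec _ idemP) eE.
Qed.

Local Notation orbits := (@char_orbits l p G K iota).
Local Notation e_ := (idem iota).

Lemma orbits_eq O w : orbits O -> O w -> orb w = O.
Proof. by case=> v vd <-; exact: orbit_eq. Qed.

Lemma ev_idem O w : orbits O -> dual_group w -> ev w (e_ O) = (`[< O w >])%:R.
Proof. by case=> v vd <-; exact: idem_ev. Qed.

Lemma idem_idem O : orbits O -> e_ O * e_ O = e_ O.
Proof.
move=> Oo; apply: ev_separates => w wd; rewrite evM // !ev_idem //.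
by case: asboolP; rewrite ?mulr1 ?mulr0.
Qed.

Lemma idem_orthogonal O O' : orbits O -> orbits O' -> O <> O' -> e_ O * e_ O' = 0.
Proof.
move=> Oo O'o OO'; apply: ev_separates => w wd; rewrite evM // !ev_idem // ev0 //.
case: asboolP => [Ow|]; rewrite ?mul0r //; case: asboolP => [O'w|]; rewrite ?mulr0 //.
by case: OO'; rewrite -(orbits_eq Oo Ow) (orbits_eq O'o O'w).
Qed.

Definition orbit_seq n : seq (set (Gamma -> K)) := undup [seq orb w | w <- dual_seq n].

Lemma orbit_seqP n O : O \in orbit_seq n <-> orbits O /\ factors_through n O.
Proof.
rewrite mem_undup; split=> [/mapP[w /dual_seqP[wd wn] ->]|[[w wd <-] wn]].
  by split; [exists w|move=> v; exact: orbit_factors].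
apply: map_f; apply/dual_seqP; split=> //; exact/wn/orbit_refl.
Qed.

Lemma sum_orbit_seq n (Q : pred (set (Gamma -> K))) w : dual_group w -> factors n w ->
  ev w (\sum_(O <- orbit_seq n | Q O) e_ O) = (Q (orb w))%:R.
Proof.
move=> wd wn; rewrite ev_sum // big_seq_cond.
have oS : orb w \in orbit_seq n.
  by apply/orbit_seqP; split; [exists w|move=> v; exact: orbit_factors].
rewrite -big_seq_cond big_mkcond (bigD1_seq (orb w)) ?undup_uniq //=.
rewrite big_seq_cond big1 => [|O /andP[/orbit_seqP[Oo _] Ow]]; last first.
  rewrite ev_idem //; case: asboolP => [/(orbits_eq Oo) E|]; last by case: ifP.
  by rewrite E eqxx in Ow.
rewrite addr0 ev_idem ?asboolT //; last by exists w.
  by case: (Q _).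
exact: orbit_refl.
Qed.

Lemma sum_idem_level n : (\sum_(O <- orbit_seq n) e_ O) n = (1 : LG) n.
Proof.
by apply: ev_separates_level => w wd wn; rewrite sum_orbit_seq // ev1.
Qed.

Lemma idem_level0 n O : orbits O -> ~ factors_through n O -> e_ O n = (0 : LG) n.
Proof.
move=> Oo nOn; apply: ev_separates_level => w wd wn; rewrite ev_idem // ev0 // asboolF //.
by move=> /(orbits_eq Oo) E; apply: nOn; rewrite -E => v; exact: orbit_factors.
Qed.

Lemma lim_sum (I : Type) (r : seq I) (F : I -> LG) n :
  (\sum_(i <- r) F i) n = \sum_(i <- r) F i n.
Proof. by elim/big_rec2: _ => // i x y _ <-. Qed.

(** Only the orbits factoring through level [k] contribute to component [k]; a
    larger index set, of level [n], allows two consecutive components to be compared. *)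
Lemma eps_sum_level m n k : (k <= n)%N ->
  \sum_(O \in Sset iota m) e_ O k =
  \sum_(O <- [seq O <- orbit_seq n | `[< Sset iota m O >]]) e_ O k.
Proof.
move=> le_kn; rewrite (fsbigE [seq O <- orbit_seq n | `[< Sset iota m O >]]).
- rewrite big_seq_cond [RHS]big_seq_cond; apply: eq_bigl => O; rewrite andbT.
  by rewrite mem_filter; case: asboolP => //= SO; rewrite mem_set ?andbT.
- by rewrite filter_uniq // undup_uniq.
- by move=> O /=; rewrite mem_filter => /andP[/asboolP].
move=> O SO; rewrite mem_filter asboolT //= => nO.
have Oo : orbits O by case: SO => w [wd _] <-; exists w.
apply: idem_level0 => // Ok; case/negP: nO; apply/orbit_seqP; split=> // w Ow.
exact: factors_le le_kn (Ok w Ow).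
Qed.

Lemma eps_level m k : eps G iota m k = \sum_(O \in Sset iota m) e_ O k.
Proof.
pose E k : gring Zl (G k) := \sum_(O \in Sset iota m) e_ O k.
have EP n : gr_map (transition G n) (E n.+1) = E n.
  rewrite /E (eps_sum_level m (leqnn n.+1)) (eps_sum_level m (leqnSn n)) rmorph_sum.
  by apply: eq_bigr => O _; exact: (lim_compP (e_ O) n).
have /(_ 0) := @xgetPex _ _ [set e : LG | forall k, e k = \sum_(O \in Sset iota m) e_ O k].
by apply; exists (InvLim EP).
Qed.

Lemma ev_eps m w : dual_group w -> ev w (eps G iota m) = (`[< Sset iota m (orb w) >])%:R.
Proof.
move=> wd; have [n wn] := dual_factors wd.
rewrite -(sum_orbit_seq (fun O => `[< Sset iota m O >]) wd wn).
rewrite !(evE _ wn) /ev_level; congr evc.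
by rewrite eps_level (eps_sum_level m (leqnn n)) -lim_sum big_filter.
Qed.

Lemma idem_eps m O : orbits O -> e_ O * eps G iota m = if `[< Sset iota m O >] then e_ O else 0.
Proof.
move=> Oo; apply: ev_separates => w wd; rewrite evM // ev_idem // ev_eps //.
case: asboolP => [Ow|nOw]; last first.
  by rewrite mul0r; case: asboolP => _; rewrite ?ev0 // ev_idem // asboolF.
rewrite (orbits_eq Oo Ow).
by case: asboolP => _; rewrite ?mulr1 ?mulr0 ?ev0 // ev_idem // asboolT.
Qed.

Lemma LmonoM c d (x y : Gamma) : Lmono c x * Lmono d y = Lmono (c * d) (x * y)%g :> LG.
Proof.
apply: ev_separates => w wd; rewrite evM // !ev_mono // rmorphM mulrACA.
by case: wd => ->.
Qed.

Lemma level0_le b k n : (k <= n)%N -> b n = 0 -> b k = 0.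
Proof.
move=> /subnK <-; elim: (n - k)%N => // d IH bd; apply: IH.
by rewrite -(lim_compP b) (bd : b (d + k)%N.+1 = 0) rmorph0.
Qed.

Lemma level_fiber b k n (t : G n) : (n <= k)%N ->
  b n t = \sum_(g : G k | lift_level g n == t) b k g.
Proof.
move=> /subnK <-; elim: (k - n)%N => [|d ->].
  rewrite (eq_bigl (pred1 t)) ?big_pred1_eq // => g.
  by rewrite /= lift_levelK.
under eq_bigr => g _ do rewrite -(lim_compP b (d + n)%N) ffunE.
rewrite (exchange_big_dep predT) //= [RHS]big_mkcond /=; apply: eq_bigr => h _.
have E : lift_level (transition G (d + n) h) n = lift_level h n.
  apply: (@pro_comp_le _ (d + n)%N); first exact: leq_addl.
  by rewrite lift_levelK -(pro_compP (lift_level h)) lift_levelK.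
rewrite -E; case: ifPn => ht.
  rewrite (big_pred1 (transition G (d + n) h)) // => g /=.
  by rewrite andbC [RHS]eq_sym; case: (transition G _ h =P g) => [<-|].
rewrite big_pred0 // => g; rewrite andbC.
by case: (transition G _ h =P g) => [<-|//]; rewrite (negbTE ht).
Qed.

(** At a higher level [k], an element vanishing at level [n] is the combination
    of the differences [g - s g], where [s g] lifts the image of [g] at level [n]. *)
Lemma level0_aug n b : b n = 0 -> aug_ideal n b.
Proof.
move=> bn0 k j.
have [le_nk|/ltnW le_kn] := leqP n k; last first.
  exists 0; last by move=> g; rewrite (level0_le le_kn bn0).
  by exists [::]; split=> //; rewrite big_nil.
pose s (g : G k) : Gamma := lift_level (lift_level g n).
exists (\sum_g (scal G (b k g) * Lmono 1 (s g)) * (Lmono 1 (lift_level g * (s g)^-1)%g - 1)).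
  exists [seq (scal G (b k g) * Lmono 1 (s g), Lmono 1 (lift_level g * (s g)^-1)%g - 1)
    | g <- index_enum (G k)]; split.
    move=> _ /mapP[g _ ->] /=; split=> //.
    exists (lift_level g * (s g)^-1)%g => //.
    by rewrite /Gker /= /s lift_levelK mulgV.
  by rewrite big_map.
have termE g : (scal G (b k g) * Lmono 1 (s g)) * (Lmono 1 (lift_level g * (s g)^-1)%g - 1)
    = Lmono (b k g) (lift_level g) - Lmono (b k g) (s g) :> LG.
  rewrite mulrBr mulr1 /scal !LmonoM !mulr1 mul1g.
  have -> : (s g * (lift_level g * (s g)^-1))%g = lift_level g.
    apply: proGroup_ext => i /=; have /centsP C := level_abelian G i.
    by rewrite (C (s g i)) ?finset.in_setT // mulgKV.
  by [].
set c := \sum_g _; suff -> : c k = b k by [].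
rewrite /c lim_sum; apply/ffunP => h; rewrite sum_ffunE.
transitivity (\sum_g ((if h == g then b k g else 0) - (if h == s g k then b k g else 0))).
  by apply: eq_bigr => g _; rewrite termE /= !ffunE lift_levelK.
rewrite sumrB -!big_mkcond (big_pred1 h) => [|g]; last exact: eq_sym.
suff -> : \sum_(g | h == s g k) b k g = 0 by rewrite subr0.
rewrite (partition_big (fun g => lift_level g n) predT) //= big1 // => t _.
have [ht|ht] := eqVneq h (lift_level t k); last first.
  apply: big_pred0 => g; apply/andP => -[/eqP hs /eqP gt].
  by case/eqP: ht; rewrite hs /s gt.
transitivity (b n t); last by rewrite bn0 ffunE.
rewrite (level_fiber b t le_nk); apply: eq_bigl => g; rewrite andbC.
by case: eqP => //= gt; rewrite /s gt ht eqxx.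
Qed.

(** * The isotypic components of a Sinnott module *)

Section SinnottModule.
Variable M : lmodType LG.
Hypothesis M_sinnott : sinnott iota M.
Local Notation V := (restricted M).
Implicit Types (x y : M) (N P : set V).

(** Seen in [V], where the l-adic integers are the scalars. *)
Definition component O : set V := mod_comp iota M O.
Local Notation comp := component.

Lemma componentP O x : orbits O -> comp O x <-> e_ O *: x = x.
Proof.
move=> Oo; split=> [[y _ <-]|<-]; last by exists x.
by rewrite scalerA idem_idem.
Qed.

Lemma component_idem O x : comp O (e_ O *: x). Proof. by exists x. Qed.

Lemma component_stable O a x : comp O x -> comp O (a *: x).
Proof. by case=> y _ <-; exists (a *: y); rewrite // !scalerA mulrC. Qed.

Lemma component_submod O : @submod l V (comp O).
Proof.
split.
- by exists 0; rewrite // scaler0.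
- by move=> _ _ [x _ <-] [y _ <-]; exists (x + y); rewrite // scalerDr.
- by move=> c x; exact: component_stable.
Qed.

(** At level [n] the idempotents sum to [1], so [1] minus their sum, which fixes [x], lies in the
    [n]-th augmentation ideal; hence [x] is in [I_n M] for all [n]. *)
Lemma components_separate x : (forall O, orbits O -> e_ O *: x = 0) -> x = 0.
Proof.
move=> x0; have [_ [sep _] _] := M_sinnott; apply: sep => n.
exists [:: (1 - \sum_(O <- orbit_seq n) e_ O, x)]; split.
  move=> q; rewrite inE => /eqP -> /=; split=> //; apply: level0_aug.
  by rewrite /= sum_idem_level subrr.
rewrite big_seq1 /= scalerBl scale1r scaler_suml big_seq big1 ?subr0 //.
by move=> O /orbit_seqP[Oo _]; exact: x0.
Qed.

(** Over the l-adic integers, [Lambda e_O] is generated by the finitely many products [e_O g], where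
    [g] lifts an element of a level through which the characters in [O] factor. *)
Lemma idem_mul_span O n a : orbits O -> factors_through n O ->
  e_ O * a = \sum_(g : G n) scal G (a n g) * (e_ O * Lmono 1 (lift_level g)).
Proof.
move=> Oo On; apply: ev_separates => w wd; rewrite ev_sum // evM // ev_idem //.
under eq_bigr do rewrite !evM // ev_scal // ev_idem // ev_mono // rmorph1 mul1r.
case: asboolP => [Ow|_]; last first.
  by rewrite mul0r big1 // => g _; rewrite mul0r mulr0.
rewrite mul1r (evE _ (On w Ow)) /ev_level /evc; apply: eq_bigr => g _.
by rewrite ffunE mul1r.
Qed.

Lemma component_zgen O : orbits O -> exists s : seq V,
  (forall x, x \in s -> comp O x) /\ comp O `<=` @zspan l V s.
Proof.
move=> Oo; have [/(_ O Oo) [s0 [s0O MOE]] _ _] := M_sinnott.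
have [n On] : exists n, factors_through n O.
  case: Oo => w wd <-; have [n wn] := dual_factors wd.
  by exists n => v; exact: orbit_factors.
pose s : seq V := [seq (e_ O * Lmono 1 (lift_level g)) *: x | g <- enum (G n), x <- s0].
exists s; split.
  move=> _ /allpairsP[[g x] [_ /= xs ->]].
  by rewrite -scalerA; exact: component_idem.
rewrite [comp O]MOE => _ [q [qP ->]]; have s_sub := zspan_submod s.
rewrite big_seq; apply: (@big_ind V (@zspan l V s) 0 +%R); [exact: submod0|exact: submodD|].
move=> [_ x] /qP /= [[a _ <-] xs]; rewrite (idem_mul_span a Oo On) scaler_suml.
apply: (@submod_sum l V _ s_sub _ _ _
  (fun g => (scal G (a n g) * (e_ O * Lmono 1 (lift_level g))) *: (x : M))) => g.
rewrite -scalerA; apply: (submodZ s_sub (a n g)).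
by apply: zspan_mem; apply/allpairsP; exists (g, x); rewrite mem_enum.
Qed.

(** * The free action of the p-power roots of unity *)

Lemma expr_action a k x : iter k (fun y => a *: y) x = a ^+ k *: x.
Proof. by elim: k => [|k IH]; rewrite ?scale1r // iterS IH scalerA exprS. Qed.

Lemma ev_exp w a k : dual_group w -> ev w (a ^+ k) = ev w a ^+ k.
Proof. by move=> wd; have [f fE] := ev_rmorphism wd; rewrite -!fE rmorphXn. Qed.

Lemma primitive_element m O : Sset iota m O -> exists gamma : Gamma,
  forall w, O w -> (p ^ m)%N.-primitive_root (w gamma).
Proof.
case=> w [wd w_range] <-.
have pm0 : (0 < p ^ m)%N by rewrite expn_gt0 prime_gt0.
have [z z_prim] := prim_root_exists K_char0 pm0.
have [gamma _ gammaE] : range w z by rewrite w_range /= prim_expr_order.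
exists gamma => _ [s _ <-] /=; rewrite fmorph_primitive_root gammaE //.
Qed.

(** [gamma] acts on the component as a primitive [p ^ m]-th root of unity, and
    [1 - zeta] divides [p], hence is a unit, for each [p]-th root of unity [zeta] other than [1]. *)
Lemma component_quotient_card m O P (T : finType) (rep : T -> V) :
    orbits O -> Sset iota m O -> @submod l V P ->
    (forall a x, P x -> P ((a : LG) *: (x : M))) ->
    (forall t, comp O (rep t)) -> (forall y, comp O y -> exists t, P (y - rep t)) ->
    (forall t t', P (rep t - rep t') -> t = t') ->
  (p ^ m %| #|T|.-1)%N.
Proof.
move=> Oo SO P_sub P_stable NT repN rep_inj.
have [gamma gammaP] := primitive_element SO.
have O_sub := component_submod O.
pose a : LG := Lmono 1 gamma.
apply: (@card_quotient_free V (comp O) P T rep (fun y => (a *: (y : M) : V)) p m) => //.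
- exact: submod0.
- exact: submodB.
- exact: submod0.
- exact: submodB.
- by move=> x y; exact: (scalerBr a (x : M) y).
- by move=> y; exact: component_stable.
- by move=> y; exact: P_stable.
- have aE : a ^+ (p ^ m) * e_ O = e_ O.
    apply: ev_separates => w wd; rewrite evM // ev_idem // ev_exp // ev_mono //.
    rewrite rmorph1 mul1r; case: asboolP => [Ow|_]; last by rewrite mulr0.
    by rewrite (prim_expr_order (gammaP w Ow)) mul1r.
  move=> y /(componentP _ Oo) yE; rewrite expr_action.
  transitivity ((a ^+ (p ^ m) * e_ O) *: (y : M)); first by rewrite -scalerA yE.
  by rewrite aE yE.
move=> m0 y Oy; rewrite expr_action; set h := a ^+ _ => Ph.
(* At each character in [O], [h] is a [p]-th root of unity other than [1]. *)
have hsum : \sum_(i < p) h ^+ i *: (y : M) = 0.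
  rewrite -scaler_suml; have /(componentP _ Oo) <- := Oy; rewrite scalerA.
  rewrite (_ : _ * _ = 0) ?scale0r //; apply: ev_separates => w wd.
  rewrite evM // ev_idem // ev0 //; case: asboolP => [Ow|_]; last by rewrite mulr0.
  rewrite mulr1 ev_sum //; set zeta := w gamma ^+ (p ^ m.-1).
  have -> : \sum_(i < p) ev w (h ^+ i) = \sum_(i < p) zeta ^+ i.
    by apply: eq_bigr => i _; rewrite !ev_exp // ev_mono // rmorph1 mul1r.
  have zeta1 : zeta - 1 != 0.
    rewrite subr_eq0 -(prim_order_dvd (gammaP w Ow)) dvdn_Pexp2l ?prime_gt1 //.
    by rewrite -ltnNge prednK.
  apply: (mulfI zeta1); rewrite mulr0 -subrX1 -exprM -expnSr prednK //.
  by rewrite (prim_expr_order (gammaP w Ow)) subrr.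
have Pi i : P (h ^+ i *: (y : M) - y).
  elim: i => [|i IH]; first by rewrite expr0 scale1r subrr; exact: (submod0 P_sub).
  have := submodD P_sub (P_stable h _ IH) Ph.
  by rewrite scalerBr scalerA -exprS addrA subrK.
(* Modulo [P] the powers of [h] fix [y], so their sum acts as [p]. *)
have Pp : P ((p%:R : Zl) *: y).
  have := submod_sum P_sub (index_enum 'I_p) xpredT (fun i => Pi (i : 'I_p)).
  rewrite sumrB hsum sub0r sumr_const card_ord => /(submodN P_sub).
  by rewrite opprK scaler_nat.
have [v pv] : exists v : Zl, p%:R * v = 1.
  by apply: padic_nat_unit => //; rewrite prime_coprime // dvdn_prime2 //; exact/eqP.
by have := submodZ P_sub v Pp; rewrite scalerA mulrC pv scale1r.
Qed.

(** * Finite sums of components *)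

Fixpoint component_sum (U : seq (set (Gamma -> K))) : set V :=
  if U is o :: U' then sum_set (comp o) (component_sum U') else [set 0].

Lemma component_sum_submod U : @submod l V (component_sum U).
Proof.
elim: U => [|O U IH] /=; last by apply: sum_submod => //; exact: component_submod.
by split=> [|x y -> ->|c x ->]; rewrite /= ?addr0 ?scaler0.
Qed.

Lemma component_sum_sub O U : O \in U -> comp O `<=` component_sum U.
Proof.
elim: U => //= O' U IH; rewrite inE => /predU1P[<-|OU] x Ox.
  exists x, 0; rewrite addr0; split=> //; exact: submod0 (component_sum_submod U).
by exists 0, x; rewrite add0r; split; [exact: submod0 (component_submod O')|exact: IH|].
Qed.

Lemma component_sum_ind U (N : set M) :
    N 0 -> (forall x y, N x -> N y -> N (x + y)) -> (forall O, O \in U -> comp O `<=` N) ->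
  component_sum U `<=` N.
Proof.
move=> N0 ND; elim: U => [|O U IH] UN /=; first by move=> x ->.
move=> _ [x [y [Ox Uy ->]]]; apply: ND; first by apply: (UN O) => //; rewrite inE eqxx.
by apply: IH Uy => O' O'U; apply: UN; rewrite inE O'U orbT.
Qed.

Lemma component_sum_orthogonal O U x : orbits O -> (forall O', O' \in U -> orbits O') ->
  O \notin U -> component_sum U x -> e_ O *: (x : M) = 0.
Proof.
move=> Oo Uo OU; move: x; apply: (@component_sum_ind U [set x | e_ O *: x = 0]).
- by rewrite /= scaler0.
- by move=> x y /= x0 y0; rewrite scalerDr x0 y0 addr0.
move=> O' O'U _ [x _ <-] /=; rewrite scalerA idem_orthogonal ?scale0r //; first exact: Uo.
by move=> OO'; rewrite OO' O'U in OU.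
Qed.

Lemma component_sum_disjoint O U : orbits O -> (forall O', O' \in U -> orbits O') ->
  O \notin U -> forall y, comp O y -> component_sum U y -> y = 0.
Proof.
move=> Oo Uo OU y /(componentP _ Oo) yE yU; rewrite -yE.
exact: (component_sum_orthogonal Oo Uo OU yU).
Qed.

Lemma component_sum_zgen U : (forall O, O \in U -> orbits O) -> exists s : seq V,
  (forall x, x \in s -> component_sum U x) /\ component_sum U `<=` @zspan l V s.
Proof.
elim: U => [_|O U IH Uo]; first by exists [::]; split.
have [|s [sU Us]] := IH; first by move=> O' O'U; apply: Uo; rewrite inE O'U orbT.
have [|s' [s'O Os']] := @component_zgen O; first by apply: Uo; rewrite inE eqxx.
have span_sub (t : seq V) : {subset t <= s' ++ s} -> @zspan l V t `<=` @zspan l V (s' ++ s).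
  move=> ts; apply: zspan_sub; first exact: zspan_submod.
  by move=> x /ts; exact: zspan_mem.
exists (s' ++ s); split.
  move=> x; rewrite mem_cat => /orP[xs'|xs].
    by apply: (@component_sum_sub O (O :: U)); [rewrite inE eqxx|exact: s'O].
  exists 0, x; rewrite add0r; split; [exact: submod0 (component_submod O)|exact: sU|by []].
move=> _ [x [y [/Os' xs' /Us ys ->]]].
apply: (submodD (zspan_submod _)); [apply: span_sub xs'|apply: span_sub ys].
  by move=> z zs'; rewrite mem_cat zs'.
by move=> z zs; rewrite mem_cat zs orbT.
Qed.

Lemma Sset_orbits m O : Sset iota m O -> orbits O.
Proof. by case=> w [wd _] <-; exists w. Qed.

(** Both ranks of [N] are dimensions of a quotient [N / F N] over the field with [l]
    elements, where [F N] is either [l N] or [l N + torsion]. Only the properties of [F]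
    that make this dimension additive, and those that let [Lambda] act on the quotient of
    a component, enter here. *)
Lemma quotient_ranks (F : set V -> set V) :
    (forall N, submod N -> submod (F N)) -> (forall N, submod N -> F N `<=` N) ->
    (forall N (y : V), submod N -> N y -> F N ((l%:R : Zl) *: y)) ->
    (forall N1 N2, submod N1 -> submod N2 -> (forall y, N1 y -> N2 y -> y = 0) ->
       F (sum_set N1 N2) = sum_set (F N1) (F N2)) ->
    (forall O a x, F (comp O) x -> F (comp O) ((a : LG) *: (x : M))) ->
  exists r : set (Gamma -> K) -> nat,
    (forall m O, Sset iota m O -> (p ^ m %| (l ^ r O).-1)%N) /\
    forall U, uniq U -> (forall O, O \in U -> orbits O) ->
      exists x : 'I_(\sum_(O <- U) r O) -> V,
        basis_mod (component_sum U) (F (component_sum U)) x.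
Proof.
move=> F_submod F_sub lF F_sum F_stable.
have ex_basis O : exists r, orbits O -> exists x : 'I_r -> V, basis_mod (comp O) (F (comp O)) x.
  have [Oo|nOo] := pselect (orbits O); last by exists 0%N.
  have O_sub := component_submod O; have [s [sO Os]] := component_zgen Oo.
  have [r [x xP]] := basis_mod_exists l_prime O_sub (F_submod _ O_sub)
    (fun y => lF _ y O_sub) sO Os.
  by exists r => _; exists x.
have [r rP] := choice ex_basis; exists r; split.
  move=> m O SO; have Oo := Sset_orbits SO; have O_sub := component_submod O.
  have [x xP] := rP O Oo.
  have [rep [repO rep_onto rep_inj]] := basis_mod_repr l_prime O_sub (F_submod _ O_sub)
    (fun y => lF _ y O_sub) xP.
  have T_card : #|{ffun 'I_(r O) -> 'I_l}| = (l ^ r O)%N by rewrite card_ffun !card_ord.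
  rewrite -T_card; apply: (component_quotient_card Oo SO (F_submod _ O_sub) _ repO) => //.
  by move=> a y; exact: F_stable.
elim=> [|O U IH] /=.
  move=> _ _; rewrite big_nil; exists (fun _ => 0); split=> [[]|y ->|c _ []] //.
  exists (fun=> 0); rewrite big_ord0 subrr; apply: submod0; apply: F_submod.
  exact: (component_sum_submod [::]).
move=> /andP[OU U_uniq] Uo; have Oo : orbits O by apply: Uo; rewrite inE eqxx.
have Uo' O' : O' \in U -> orbits O' by move=> O'U; apply: Uo; rewrite inE O'U orbT.
have [x xP] := IH U_uniq Uo'; have [x' x'P] := rP O Oo.
have O_sub := component_submod O; have U_sub := component_sum_submod U.
have disj := component_sum_disjoint Oo Uo' OU.
rewrite big_cons F_sum //; eexists.
by apply: (basis_mod_sum O_sub _ U_sub _ _ _ disj x'P xP); auto.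
Qed.

(** * Torsion components *)

Lemma poly_of_evaluation (g : {poly Zl}) a : exists b : LG,
  forall w, dual_group w -> ev w b = (map_poly iota g).[ev w a].
Proof.
elim/poly_ind: g => [|g c [b bE]].
  by exists 0 => w wd; rewrite ev0 // rmorph0 horner0.
exists (b * a + scal G c) => w wd.
rewrite rmorphD rmorphM /= map_polyX map_polyC hornerMXaddC -bE //.
have [f fE] := ev_rmorphism wd; rewrite -!fE rmorphD rmorphM !fE.
by rewrite ev_scal.
Qed.

(** A nonzero [a] in [Lambda e_O] divides [c e_O] for some nonzero l-adic integer [c], the constant
    term of an algebraic equation for the value of [a] at a character in [O]; the
    values at the other characters in [O] are conjugate, so they satisfy the same equation. *)
Lemma torsion_component O x : torsion_mod iota M -> orbits O -> comp O x ->
  exists k, ((l ^ k)%:R : Zl) *: (x : V) = 0.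
Proof.
move=> M_tors Oo Ox; have [a [[a' _ aE] a0] ax] := M_tors O Oo x Ox.
have [w wd wa] : exists2 w, dual_group w & ev w a <> 0.
  apply: contrapT => H; apply: a0; apply: ev_separates => w wd; rewrite ev0 //.
  by apply: contrapT => wa; apply: H; exists w.
have Ow : O w.
  apply: contrapT => nOw; apply: wa.
  by rewrite -aE evM // ev_idem // asboolF // mul0r.
have [g [c [c0 gE]]] := algebraic_neq0 (proj2 K_closure) (introN eqP wa).
have [b bE] := poly_of_evaluation g a.
have e0 : e_ O * (b * a + scal G c) = 0.
  apply: ev_separates => v vd; rewrite evM // ev_idem // ev0 //.
  case: asboolP => [Ov|_]; rewrite ?mul0r // mul1r.
  have [f fE] := ev_rmorphism vd; rewrite -fE rmorphD rmorphM !fE ev_scal // bE //.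
  have [s sg vE] : orb w v by rewrite (orbits_eq Oo Ow).
  rewrite -vE ev_galois // -[RHS](rmorph0 s) -gE rmorphD rmorphM; have [_ s_iota] := sg.
  rewrite s_iota -horner_map; congr (_.[_] * _ + _).
  by apply/polyP => i; rewrite !coef_map /= s_iota.
have cx : scal G c *: x = 0.
  have := scale0r x; rewrite -e0 mulrC -scalerA ((componentP x Oo).1 Ox) scalerDl -scalerA ax.
  by rewrite scaler0 add0r.
have [k [u [v [cE uv]]]] := padic_factor l_prime c0; exists k.
have -> : ((l ^ k)%:R : Zl) *: (x : V) = (v : Zl) *: ((c : Zl) *: (x : V)).
  by rewrite scalerA cE mulrCA (mulrC v) uv mulr1.
by rewrite [c *: _]cx scaler0.
Qed.

Lemma component_cardinals : torsion_mod iota M ->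
  exists c : set (Gamma -> K) -> nat,
    (forall m O, Sset iota m O -> (p ^ m %| (c O).-1)%N) /\
    (forall O, orbits O -> exists j, c O = (l ^ j)%N) /\
    forall U, uniq U -> (forall O, O \in U -> orbits O) ->
      exists t : seq M, [/\ uniq t, forall y, component_sum U y <-> y \in t &
        size t = (\prod_(O <- U) c O)%N].
Proof.
move=> M_tors.
have ex_enum O : exists c, orbits O -> exists t : seq M,
    [/\ uniq t, forall y, comp O y <-> y \in t, size t = c & exists j, c = (l ^ j)%N].
  have [Oo|nOo] := pselect (orbits O); last by exists 0%N.
  have [s [sO Os]] := component_zgen Oo.
  have [x /sO|t [t_uniq tP [j tj]]] := @zspan_torsion_finite l l_prime V s.
    exact: torsion_component.
  exists (size t) => _; exists t; split=> //; last by exists j.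
  move=> y; rewrite -tP; split; first exact: Os.
  exact: (zspan_sub (component_submod O) sO).
have [c cP] := choice ex_enum; exists c; split; last split.
- move=> m O SO; have Oo := Sset_orbits SO; have [t [t_uniq tP tc _]] := cP O Oo.
  have tcard : #|'I_(size t)| = c O by rewrite card_ord.
  rewrite -tcard.
  apply: (@component_quotient_card m O [set 0] _ (fun i : 'I_(size t) => (nth 0 t i : V))) => //.
  + exact: (component_sum_submod [::]).
  + by move=> a y ->; rewrite /= scaler0.
  + by move=> i; apply/tP; exact: mem_nth.
  + move=> y /tP yt; have lt_y : (index y t < size t)%N by rewrite index_mem.
    by exists (Ordinal lt_y); rewrite /= nth_index // subrr.
  + move=> i j /eqP; rewrite subr_eq0 => /eqP/eqP.
    by rewrite nth_uniq // => /eqP/val_inj.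
- by move=> O Oo; have [t [_ _ _]] := cP O Oo.
elim=> [|O U IH] /=.
  move=> _ _; exists [:: 0]; rewrite big_nil; split=> // y.
  by rewrite inE; split=> [->|/eqP].
move=> /andP[OU U_uniq] Uo; have Oo : orbits O by apply: Uo; rewrite inE eqxx.
have Uo' O' : O' \in U -> orbits O' by move=> O'U; apply: Uo; rewrite inE O'U orbT.
have [t [t_uniq tP tc]] := IH U_uniq Uo'; have [t' [t'_uniq t'P t'c _]] := cP O Oo.
exists [seq x + y | x <- t', y <- t]; split.
- apply: allpairs_uniq => //.
  move=> _ _ /allpairsP[[x y] [/= /t'P xO /tP yU ->]] /allpairsP[[x' y'] [/= /t'P x'O /tP y'U ->]].
  move=> /= E.
  have xx' : x = x'.
    have e0 := component_sum_orthogonal Oo Uo' OU.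
    have := congr1 (fun z => e_ O *: z) E; rewrite /= !scalerDr (e0 y) // (e0 y') //.
    by rewrite !addr0 ((componentP x Oo).1 xO) ((componentP x' Oo).1 x'O).
  by move: E; rewrite xx' => /addrI ->.
- move=> z; split.
    move=> [x [y [/t'P xt' /tP yt ->]]]; apply/allpairsP; exists (x, y); split=> //.
  by move=> /allpairsP[[x y] [/= /t'P xO /tP yU ->]]; exists x, y.
- by rewrite size_allpairs t'c tc big_cons.
Qed.

(** * From bases of quotients to ranks *)

Lemma Zfingen_of_zspan N (s : seq V) :
  submod N -> (forall x, x \in s -> N x) -> N `<=` @zspan l V s -> @Zfingen l p G M N.
Proof.
move=> N_sub sN Ns; exists s; split; first by move=> x; exact: sN.
apply/seteqP; split=> [y /Ns|y [q [qP ->]]].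
  elim: s {sN Ns} y => [y ->|x s IH y [c /IH[q [qP qE]]]].
    by exists [::]; rewrite big_nil.
  exists ((scal G c, x) :: q); split.
    move=> z; rewrite inE => /predU1P[->|/qP[? zs]] /=.
      by split; [exists c|rewrite inE eqxx].
    by split=> //; rewrite /= inE zs orbT.
  by rewrite big_cons -qE addrC; apply/esym/subrK.
rewrite big_seq; apply: (@big_ind V N 0 +%R); [exact: submod0|exact: submodD|].
by move=> [_ x] /qP /= [[c _ <-] /sN xN]; exact: (submodZ N_sub c).
Qed.

Lemma Zrank_of_basis N (s : seq V) r (x : 'I_r -> V) :
    submod N -> (forall y, y \in s -> N y) -> N `<=` @zspan l V s ->
    basis_mod N (lmul_torsion N) x ->
  @Zrank l p G M N r.
Proof.
move=> N_sub sN Ns xP; have [x_ind x_gen] := basis_mod_torsion l_prime N_sub sN Ns xP.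
have [Nx _ _] := xP; split; first exact: (Zfingen_of_zspan N_sub sN Ns).
  by exists x.
move=> y Ny y_ind.
have [d [[j dj] d0]] := dependent_of_span l_prime (fun j => x_gen (y j) (Ny j)).
by apply: dj; exact: y_ind.
Qed.

Lemma lrank_of_basis N (s : seq V) r (x : 'I_r -> V) :
    submod N -> (forall y, y \in s -> N y) -> N `<=` @zspan l V s ->
    basis_mod N (lmul_set N) x ->
  @lrank l p G M N r.
Proof.
move=> N_sub sN Ns [Nx gen ind]; split; first exact: (Zfingen_of_zspan N_sub sN Ns).
have lt_F (c : 'F_l) : (c < l)%N by rewrite -[X in (_ < X)%N](Fp_cast l_prime).
exists x; split=> //.
- move=> y /gen[c yc]; pose c' i : 'F_l := inZp (residue (c i) 0).
  have c'E i : c' i = residue (c i) 0 :> nat.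
    rewrite /= Fp_cast // modn_small //.
    by rewrite -[X in (_ < X)%N]expn1 residue_lt // prime_gt1.
  exists c'; rewrite -(subrK (\sum_i c i *: x i) (y : V)) -addrA.
  apply: (submodD (lmul_submod N_sub) yc); rewrite -sumrB.
  apply: (submod_sum (lmul_submod N_sub)) => i.
  have [b cE] := padic_approx (prime_gt1 l_prime) (c i) 0.
  have cb : c i - (residue (c i) 0)%:R = (l ^ 1)%:R * b.
    by apply/eqP; rewrite subr_eq addrC -cE.
  rewrite c'E -(scaler_nat (residue (c i) 0) (x i : V)) -(@scalerBl Zl V) cb expn1 -scalerA.
  by apply: lmul_setP; exact: submodZ.
- move=> c; have -> : \sum_i x i *+ c i = \sum_i ((c i : nat)%:R : Zl) *: (x i : V) :> V.
    by apply: eq_bigr => i _; rewrite scaler_nat.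
  move=> /(ind (fun i => (c i : nat)%:R)) c0 i; apply: val_inj.
  by have := c0 i; rewrite residue_nat ?prime_gt1 // expn1 modn_small.
Qed.

(** * The truncations and the limits *)

Lemma nonzero_components m : exists s : seq (set (Gamma -> K)),
  uniq s /\ forall O, O \in s <-> Sset iota m O /\ mod_comp iota M O <> [set 0].
Proof.
have [_ _ /(_ m)/finite_seqP[s sE]] := M_sinnott.
exists (undup s); split=> [|O]; first exact: undup_uniq.
rewrite mem_undup; have := congr1 (fun A => A O) sE => /= E.
by rewrite [_ /\ _]E.
Qed.

Definition layer m := projT1 (cid (nonzero_components m)).

Lemma layer_uniq m : uniq (layer m).
Proof. by rewrite /layer; case: cid => s []. Qed.

Lemma layerP m O : O \in layer m <-> Sset iota m O /\ mod_comp iota M O <> [set 0].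
Proof. by rewrite /layer; case: cid => s []. Qed.

(** Each layer only adds the orbits not yet listed, which makes the list duplicate-free by
    construction. *)
Fixpoint layers n :=
  if n is n'.+1 then [seq C <- layer n | C \notin layers n'] ++ layers n' else layer 0.

Lemma layers_uniq n : uniq (layers n).
Proof.
elim: n => [|n IH]; first exact: layer_uniq.
rewrite [layers _]/= cat_uniq filter_uniq ?layer_uniq // IH andbT /=.
by apply/hasPn => O OU; rewrite mem_filter OU.
Qed.

Lemma layersP n O : O \in layers n <-> exists2 m, (m <= n)%N & O \in layer m.
Proof.
elim: n => [|n IH].
  by split=> [OT|[m]]; [exists 0%N|rewrite leqn0 => /eqP ->].
rewrite [layers _]/= mem_cat mem_filter; split.
  move=> /orP[/andP[_ OT]|/IH[m mn OT]]; first by exists n.+1.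
  by exists m; rewrite // ltnW.
move=> [m]; rewrite leq_eqVlt => /orP[/eqP -> OT|mn OT].
  by rewrite OT andbT orNb.
by rewrite (IH.2 _) ?orbT //; exists m.
Qed.

Lemma layers_orbits n O : O \in layers n -> orbits O.
Proof. by move=> /layersP[m _ /layerP[SO _]]; exact: Sset_orbits SO. Qed.

(** The convergent sum [eps m] acts on [M] as a finite sum: the difference is killed by
    all the idempotents, hence is zero by completeness. *)
Lemma eps_scale m x : eps G iota m *: x = \sum_(O <- layer m) e_ O *: x.
Proof.
apply/eqP; rewrite -subr_eq0; apply/eqP/components_separate => O Oo.
rewrite scalerBr scalerA idem_eps // scaler_sumr.
have other O' : O' \in layer m -> O' != O -> e_ O *: (e_ O' *: x) = 0.
  move=> /layerP[SO' _] /eqP O'O; rewrite scalerA idem_orthogonal ?scale0r //.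
    exact: Sset_orbits SO'.
  by move=> OO'; apply: O'O.
have [OT|OT] := boolP (O \in layer m).
  have /layerP[SO _] := OT; rewrite asboolT // (bigD1_seq O) ?layer_uniq //=.
  rewrite scalerA idem_idem // big_seq_cond big1 ?addr0 ?subrr // => O' /andP[O'T O'O].
  exact: other.
rewrite [X in _ - X]big_seq big1 ?subr0 => [|O' O'T]; last first.
  by apply: other => //; apply: contraNneq OT => <-.
case: asboolP => [SO|_]; last by rewrite scale0r.
have MO0 : mod_comp iota M O = [set 0].
  by apply: contrapT => MO; case/negP: OT; apply/layerP.
have : mod_comp iota M O (e_ O *: x) by exists x.
by rewrite MO0.
Qed.

Lemma mod_trunc_layers n : mod_trunc iota M n = component_sum (layers n).
Proof.
have U_sub := component_sum_submod (layers n).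
apply/seteqP; split.
  move=> _ [y ->].
  apply: (@submod_sum l V _ U_sub _ _ _ (fun m : 'I_n.+1 => eps G iota m *: y m)) => m.
  rewrite eps_scale big_seq; apply: (@big_ind V (component_sum (layers n)) 0 +%R).
  - exact: submod0.
  - exact: submodD.
  move=> O OT; apply: (@component_sum_sub O); last exact: component_idem.
  by apply/layersP; exists m; rewrite // -ltnS.
apply: component_sum_ind.
- by exists (fun=> 0); rewrite big1 // => m _; rewrite scaler0.
- move=> _ _ [x ->] [y ->]; exists (fun m => x m + y m).
  by rewrite -big_split; apply: eq_bigr => m _; rewrite scalerDr.
move=> O /layersP[m le_mn /layerP[SO _]] x Ox; have Oo := Sset_orbits SO.
have lt_m : (m < n.+1)%N by rewrite ltnS.
exists (fun i => if i == m then x else 0).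
rewrite (bigD1 (Ordinal lt_m)) //= eqxx big1 => [|i im]; last first.
  by rewrite ifN ?scaler0 //; apply: contra im => /eqP im; apply/eqP/val_inj.
have /(componentP x Oo) {1}<- := Ox.
by rewrite addr0 -[in RHS]((componentP x Oo).1 Ox) scalerA mulrC idem_eps // asboolT.
Qed.

(** The increments of the ranks are divisible by arbitrarily high powers of [p]. *)
Lemma layer_cvg (r : set (Gamma -> K) -> nat) :
    (forall m O, Sset iota m O -> (p ^ m %| (l ^ r O).-1)%N) ->
  padic_cvg p (fun n => \sum_(O <- layers n) r O)%N.
Proof.
move=> rP; apply: padic_cvg_step; first exact: prime_gt1.
move=> k; have [|m0 m0P] := @dvdn_expn_pred p l k p_prime (prime_gt1 l_prime).
  by rewrite prime_coprime // dvdn_prime2 //; apply/eqP => /esym.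
exists m0 => n le_n; rewrite [layers n.+1]/= big_cat /=.
set new := [seq C <- layer n.+1 | C \notin layers n].
suff /eqP new0 : (p ^ k %| \sum_(O <- new) r O)%N by rewrite -modnDml new0 add0n.
rewrite big_seq; apply: dvdn_sum => O; rewrite mem_filter => /andP[_ /layerP[SO _]].
by apply: (m0P n.+1); [exact: leqW|exact: rP].
Qed.

(** The quotients of consecutive cardinals tend to [1]. *)
Lemma layer_prod_cvg (c : set (Gamma -> K) -> nat) :
    (forall m O, Sset iota m O -> (p ^ m %| (c O).-1)%N) ->
    (forall O, orbits O -> (0 < c O)%N) ->
  padic_cvg p (fun n => \prod_(O <- layers n) c O)%N.
Proof.
move=> cP c0; apply: padic_cvg_step; first exact: prime_gt1.
move=> k; exists k => n le_n; rewrite [layers n.+1]/= big_cat /=.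
set new := [seq C <- layer n.+1 | C \notin layers n].
suff new1 : (\prod_(O <- new) c O = 1 %[mod p ^ k])%N.
  by rewrite -modnMml new1 modnMml mul1n.
rewrite big_seq; elim/big_rec: _ => // O x; rewrite mem_filter.
move=> /andP[_ /layerP[SO _]] x1; rewrite -modnMmr x1 modnMmr muln1; apply/eqP.
rewrite eqn_mod_dvd ?c0 //; last exact: Sset_orbits SO.
by rewrite subn1 (dvdn_trans _ (cP _ _ SO)) // dvdn_exp2l // leqW.
Qed.

Lemma lmul_stable O a x : lmul_set (comp O) x -> lmul_set (comp O) (a *: x).
Proof.
by case=> y Oy <-; exists (a *: y); [exact: component_stable|rewrite -scalerMnr].
Qed.

Lemma lmul_torsion_stable O a x :
  @lmul_torsion l V (comp O) x -> @lmul_torsion l V (comp O) (a *: x).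
Proof.
case=> y [t [ly [Ot [k kt]] ->]]; exists (a *: (y : M)), (a *: (t : M)); split.
- exact: lmul_stable.
- split; first exact: component_stable.
  exists k; have : a *: (scal G (l ^ k)%:R *: (t : M)) = 0 by rewrite [X in a *: X]kt scaler0.
  by rewrite scalerA mulrC -scalerA.
- exact: (scalerDr a (y : M) t).
Qed.

Lemma Zranks_converge : exists a : nat -> nat,
  (forall n, Zrank (mod_trunc iota M n) (a n)) /\ padic_cvg p a.
Proof.
have [||||O a x|r [r_dvd rP]] := @quotient_ranks (@lmul_torsion l V).
- exact: lmul_torsion_submod.
- exact: lmul_torsion_sub.
- move=> N y N_sub Ny; exists ((l%:R : Zl) *: y), 0; rewrite addr0.
  by split; [exact: lmul_setP|exact: submod0 (torsion_submod N_sub)|].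
- exact: lmul_torsion_sum.
- exact: lmul_torsion_stable.
exists (fun n => \sum_(O <- layers n) r O)%N; split; last exact: layer_cvg.
move=> n; rewrite mod_trunc_layers; have U_orbits := @layers_orbits n.
have [s [sU Us]] := component_sum_zgen U_orbits.
have [x xP] := rP _ (layers_uniq n) U_orbits.
exact: (Zrank_of_basis (component_sum_submod _) sU Us xP).
Qed.

Lemma lranks_converge : exists b : nat -> nat,
  (forall n, lrank (mod_trunc iota M n) (b n)) /\ padic_cvg p b.
Proof.
have [||||O a x|r [r_dvd rP]] := @quotient_ranks (@lmul_set l V).
- exact: lmul_submod.
- exact: lmul_sub.
- by move=> N y _; exact: lmul_setP.
- by move=> N1 N2 _ _ _; exact: lmul_sum.
- exact: lmul_stable.
exists (fun n => \sum_(O <- layers n) r O)%N; split; last exact: layer_cvg.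
move=> n; rewrite mod_trunc_layers; have U_orbits := @layers_orbits n.
have [s [sU Us]] := component_sum_zgen U_orbits.
have [x xP] := rP _ (layers_uniq n) U_orbits.
exact: (lrank_of_basis (component_sum_submod _) sU Us xP).
Qed.

Lemma cardinals_converge : torsion_mod iota M -> exists c : nat -> nat,
  (forall n, (mod_trunc iota M n #= `I_(c n))%card /\ c n = (l ^ logn l (c n))%N) /\
  padic_cvg p c.
Proof.
move=> M_tors; have [c [c_dvd [c_pow cP]]] := component_cardinals M_tors.
exists (fun n => \prod_(O <- layers n) c O)%N; split; last first.
  by apply: layer_prod_cvg => // O /c_pow[j ->]; rewrite expn_gt0 prime_gt0.
move=> n; have U_orbits := @layers_orbits n; split.
  have [t [t_uniq tP <-]] := cP _ (layers_uniq n) U_orbits.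
  have -> : mod_trunc iota M n = [set` t].
    by rewrite mod_trunc_layers; apply/seteqP; split=> x /tP.
  have -> : [set` t] = nth 0 t @` `I_(size t).
    apply/seteqP; split=> [x /= xt|_ [i /= lt_i <-]]; last exact: mem_nth.
    by exists (index x t); rewrite /= ?index_mem // nth_index.
  apply: inj_card_eq => i j; rewrite !inE => lt_i lt_j /eqP.
  by rewrite nth_uniq // => /eqP.
have [j ->] : exists j, (\prod_(O <- layers n) c O = l ^ j)%N.
  rewrite big_seq; elim/big_rec: _ => [|O x /U_orbits/c_pow[i ->] [j ->]]; first by exists 0%N.
  by exists (i + j)%N; rewrite expnD.
by rewrite pfactorK.
Qed.

End SinnottModule.
End Dual.

Theorem theorem4p11 (p l : nat) (hp : prime p) (hl : prime l) (hlp : l <> p)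
    (G : pro_p_system p)
    (K : closedFieldType) (iota : {rmorphism padic_int l -> K})
    (hK : is_algclosure iota)
    (M : lmodType (Lambda l G)) (hM : sinnott iota M) :
  (exists a : nat -> nat,
     (forall n, Zrank (mod_trunc iota M n) (a n)) /\ padic_cvg p a) /\
  (exists b : nat -> nat,
     (forall n, lrank (mod_trunc iota M n) (b n)) /\ padic_cvg p b) /\
  (torsion_mod iota M ->
   exists c : nat -> nat,
     (forall n, (mod_trunc iota M n #= `I_(c n))%card /\
                c n = (l ^ logn l (c n))%N) /\
     padic_cvg p c).
Proof.
split; first exact: (Zranks_converge hp hl hlp hK hM).
split; first exact: (lranks_converge hp hl hlp hK hM).
exact: (cardinals_converge hp hl hlp hK hM).
Qed.
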